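(* For every integer $q\ge3$, $$f(q)\le\frac{25q^2+41q-16}{2},$$ where $f(q)$ is the least integer such that every $f(q)$-connected graph has a $q$-connected orientation.
   Context: All graphs are finite and simple. For a positive integer $k$, a graph $G$ is $k$-connected if $|V(G)|\ge k+1$ and $G-S$ is connected for every $S\subseteq V(G)$ with $|S|<k$. An orientation of a graph (assigning one direction to each edge) is $q$-connected if the resulting digraph has at least $q+1$ vertices and remains strongly connected after the deletion of any set of fewer than $q$ vertices. *)

(* Defs.v *)
From HB Require Import structures.
From mathcomp Require Import all_boot.

Set Implicit Arguments.
Unset Strict Implicit.
Unset Printing Implicit Defensive.

Record sgraph := SGraph {
  vertex :> finType;
  adj : rel vertex;
  adj_sym : symmetric adj;
  adj_irr : irreflexive adj
}.

Definition delete (T : finType) (r : rel T) (S : {set T}) : rel T :=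
  [rel x y in ~: S | r x y].

Definition graph_connected_minus (G : sgraph) (S : {set G}) : Prop :=
  forall x y : G, x \notin S -> y \notin S -> connect (delete (@adj G) S) x y.

Definition k_connected (k : nat) (G : sgraph) : Prop :=
  k.+1 <= #|G| /\ forall S : {set G}, #|S| < k -> graph_connected_minus S.

(* A digraph on T is a relation d; d x y is the arc from x to y.  Applied to all
   ordered pairs (x, y), directed reachability is strong connectivity. *)
Definition strongly_connected_minus (T : finType) (d : rel T) (S : {set T}) :
    Prop :=
  forall x y : T, x \notin S -> y \notin S -> connect (delete d S) x y.

Definition q_connected_digraph (q : nat) (T : finType) (d : rel T) : Prop :=
  q.+1 <= #|T| /\ forall S : {set T}, #|S| < q -> strongly_connected_minus d S.

(* Every arc lies on an edge, and every edge carries exactly one of its two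
   possible directions. *)
Definition orientation (G : sgraph) (d : rel G) : Prop :=
  (forall x y : G, d x y -> adj x y) /\
  (forall x y : G, adj x y -> d x y = ~~ d y x).

Definition has_q_connected_orientation (q : nat) (G : sgraph) : Prop :=
  exists d : rel G, orientation d /\ q_connected_digraph q d.

Definition connectivity_suffices (q k : nat) : Prop :=
  forall G : sgraph, k_connected k G -> has_q_connected_orientation q G.

(* "m = f(q)".  A relation, since the existence of f(q) is itself part of what
   has to be proved; k-connectivity is only defined for positive k. *)
Definition is_f (q m : nat) : Prop :=
  [/\ 0 < m, connectivity_suffices q m
    & forall k : nat, 0 < k -> connectivity_suffices q k -> m <= k].

(* Main.v *)
Require Import Defs.
From HB Require Import structures.
From mathcomp Require Import all_boot all_order all_algebra.
From mathcomp Require Import zify ring lra.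
From Stdlib Require Import Classical.

(** We show that 8q^2 + 8q-connected graphs suffice.  Put d = 2q - 1 and
    c = d(d+1)/2.  A vertex count based on random orderings, applied to the
    closed sets of the generic d-dimensional rigidity matroid, shows that a
    2d(d+1)-connected graph satisfies the base packing condition for two bases;
    hence it has two edge-disjoint spanning subgraphs H1, H2, each with
    d|V| - c edges and inducing at most d|W| - c edges on every W with |W| >= d.

    Orient H1 with all in-degrees equal to d, except in-degree d - 1 on a set R0
    of c vertices; orient H2 in the same way with out-degrees.  Let S be a set of
    fewer than q vertices and let X, Y partition V - S so that no arc goes from
    Y to X.  Counting the arcs of H1 with head in X and those of H2 with tail in
    Y shows that X and Y both contain at least d vertices of R0.

    To exclude this, let P be a smallest set of at least 2q^2 vertices on which
    G - H1 - H2 has at least 4q^2|P| - 4q^4 edges.  Proper subsets of P are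
    sparser, so exactly that many of these edges can be oriented with in-degree
    4q^2, reduced to 2q^2 on a subset R of P of size 2q^2 that contains R0.  The
    same count then shows that Y contains at most 2(q - 1) < d vertices of R. *)

Set Implicit Arguments.
Unset Strict Implicit.
Unset Printing Implicit Defensive.

Import Order.TTheory GRing.Theory Num.Theory.

(** * Packing two bases *)

Lemma disjoint_setU1 (T : finType) (x : T) (A B : {set T}) :
  [disjoint x |: A & B] = (x \notin B) && [disjoint A & B].
Proof.
by rewrite -disjointU1; apply: eq_disjoint => y; rewrite !inE.
Qed.

Section Packing.
Variables (T : finType) (r : {set T} -> nat).
Hypothesis r_sub : forall A B : {set T}, r (A :|: B) + r (A :&: B) <= r A + r B.
Hypothesis r_mono : forall A B : {set T}, A \subset B -> r A <= r B.
Hypothesis r_card : forall A : {set T}, r A <= #|A|.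

(* If an element [e] of [J] can be added neither to [X1] nor to [X2], take violating sets [A]
   and [B] for the two choices: by submodularity, [e |: (A :|: B)] or [A :&: B] violates the
   hypothesis on [J]. *)
Lemma extend_two_independent (J X1 X2 : {set T}) :
  [disjoint J & X1] -> [disjoint J & X2] -> [disjoint X1 & X2] ->
  (forall A : {set T}, A \subset J ->
     #|A| + #|X1| + #|X2| <= r (A :|: X1) + r (A :|: X2)) ->
  exists I1 I2 : {set T}, [/\ I1 :|: I2 = J :|: X1 :|: X2, [disjoint I1 & I2],
    #|I1| <= r I1 & #|I2| <= r I2].
Proof.
elim: {J}_.+1 {-2}J (ltnSn #|J|) X1 X2 => // n IHn J ltJn X1 X2 dJ1 dJ2 d12 hJ.
have [J0|[e eJ]] := set_0Vmem J.
  exists X1, X2; have := hJ set0 (sub0set _); rewrite J0 !set0U cards0.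
  by have := r_card X1; have := r_card X2; split=> //; lia.
have eX1 : e \notin X1 by rewrite (disjointFr dJ1 eJ).
have eX2 : e \notin X2 by rewrite (disjointFr dJ2 eJ).
have ltJ' : #|J :\ e| < n by rewrite (cardsD1 e) eJ in ltJn; lia.
have dJ' (X : {set T}) : [disjoint J & X] -> [disjoint J :\ e & X].
  by apply: disjointWl; apply: subD1set.
have dJe (X : {set T}) : [disjoint J & X] -> [disjoint J :\ e & e |: X].
  by move=> dJX; rewrite disjoint_sym disjoint_setU1 !inE eqxx disjoint_sym dJ'.
have [h1|/forallPn[A]] := boolP [forall A : {set T}, (A \subset J :\ e) ==>
   (#|A| + #|e |: X1| + #|X2| <= r (A :|: (e |: X1)) + r (A :|: X2))].
  case: (IHn (J :\ e) ltJ' (e |: X1) X2) => //; [exact: dJe|exact: dJ'| | |].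
  - by rewrite disjoint_setU1 eX2.
  - by move=> A sA; have /forallP/(_ A) := h1; rewrite sA.
  move=> I1 [I2 [h d i1 i2]]; exists I1, I2; split=> //.
  rewrite h; apply/setP=> z; rewrite !inE; case: (eqVneq z e) => [->|_]; rewrite ?eJ ?orbT //.
rewrite negb_imply -ltnNge => /andP[sA hA].
have [h2|/forallPn[B]] := boolP [forall A : {set T}, (A \subset J :\ e) ==>
   (#|A| + #|X1| + #|e |: X2| <= r (A :|: X1) + r (A :|: (e |: X2)))].
  case: (IHn (J :\ e) ltJ' X1 (e |: X2)) => //; [exact: dJ'|exact: dJe| | |].
  - by rewrite disjoint_sym disjoint_setU1 eX1 disjoint_sym.
  - by move=> A' sA'; have /forallP/(_ A') := h2; rewrite sA'.
  move=> I1 [I2 [h d i1 i2]]; exists I1, I2; split=> //.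
  rewrite h; apply/setP=> z; rewrite !inE; case: (eqVneq z e) => [->|_]; rewrite ?eJ ?orbT //.
rewrite negb_imply -ltnNge => /andP[sB hB].
have eA : e \notin A by apply/negP=> /(subsetP sA); rewrite !inE eqxx.
have eB : e \notin B by apply/negP=> /(subsetP sB); rewrite !inE eqxx.
have s1 := r_sub (A :|: (e |: X1)) (B :|: X1).
have s2 := r_sub (A :|: X2) (B :|: (e |: X2)).
have U1 : A :|: (e |: X1) :|: (B :|: X1) = (e |: (A :|: B)) :|: X1.
  by apply/setP=> z; rewrite !inE;
     case: (z == e); case: (z \in A); case: (z \in B); case: (z \in X1).
have U2 : A :|: X2 :|: (B :|: (e |: X2)) = (e |: (A :|: B)) :|: X2.
  by apply/setP=> z; rewrite !inE;
     case: (z == e); case: (z \in A); case: (z \in B); case: (z \in X2).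
have V1 : (A :|: (e |: X1)) :&: (B :|: X1) = (A :&: B) :|: X1.
  apply/setP=> z; rewrite !inE; case: (eqVneq z e) => [->|_].
    by rewrite (negPf eA) (negPf eB) (negPf eX1).
  by case: (z \in A); case: (z \in B); case: (z \in X1).
have V2 : (A :|: X2) :&: (B :|: (e |: X2)) = (A :&: B) :|: X2.
  apply/setP=> z; rewrite !inE; case: (eqVneq z e) => [->|_].
    by rewrite (negPf eA) (negPf eB) (negPf eX2).
  by case: (z \in A); case: (z \in B); case: (z \in X2).
rewrite U1 V1 in s1; rewrite U2 V2 in s2.
have sJ : J :\ e \subset J by apply: subD1set.
have k1 : e |: (A :|: B) \subset J.
  by rewrite subUset sub1set eJ subUset (subset_trans sA sJ) (subset_trans sB sJ).
have k2 : A :&: B \subset J by apply: subset_trans (subsetIl _ _) (subset_trans sA sJ).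
have m1 := hJ _ k1; have m2 := hJ _ k2; have m3 := cardsUI A B.
rewrite !cardsU1 eX1 eX2 !inE (negPf eA) (negPf eB) /= in hA hB m1 m2.
move: s1 s2 hA hB m1 m2 m3; clear.
move: (r _) (r _) (r _) (r _) (r _) (r _) (r _) (r _).
move: #|A| #|B| #|X1| #|X2| #|A :|: B| #|A :&: B|; lia.
Qed.

(** Matroid union for two copies of the matroid with rank [r], where [#|I| <= r I] expresses
    independence. A maximal [J] meeting the union-independence condition has at least
    [#|E :\: C| + 2 * r C] elements for the largest tight set [C], and [extend_two_independent] with
    empty [X1] and [X2] splits [J]. *)
Theorem base_packing (E : {set T}) (R : nat) :
  (forall C : {set T}, C \subset E -> 2 * R <= #|E :\: C| + 2 * r C) ->
  exists I1 I2 : {set T}, [/\ I1 :|: I2 \subset E, [disjoint I1 & I2],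
    #|I1| <= r I1, #|I2| <= r I2 & 2 * R <= #|I1| + #|I2|].
Proof.
move=> hE.
pose P (J : {set T}) :=
  (J \subset E) && [forall A : {set T}, (A \subset J) ==> (#|A| <= 2 * r A)].
have P0 : P set0.
  rewrite /P sub0set; apply/forallP=> A; apply/implyP; rewrite subset0 => /eqP->.
  by rewrite cards0.
have [J /maxsetP[/andP[sJ /forallP hJ] maxJ] _] := maxset_exists P0.
have hJ' (A : {set T}) : A \subset J -> #|A| <= 2 * r A by move=> sA; have := hJ A; rewrite sA.
(* The tight sets are closed under union, and the largest one contains [E :\: J]. *)
pose tight (C : {set T}) := (C \subset E) && (2 * r C <= #|C :&: J|).
have tU (C C' : {set T}) : tight C -> tight C' -> tight (C :|: C').
  move=> /andP[sC tC] /andP[sC' tC']; rewrite /tight subUset sC sC' /=.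
  have := r_sub C C'; have := hJ' (C :&: C' :&: J) (subsetIr _ _).
  have := r_mono (subsetIl (C :&: C') J).
  have := cardsUI (C :&: J) (C' :&: J).
  by rewrite -setIUl setIACA setIid; lia.
have tight0 : tight set0.
  by rewrite /tight sub0set; have := r_card set0; rewrite cards0; lia.
have [C /maxsetP[tC maxC] _] := maxset_exists tight0.
have EJC : E :\: J \subset C.
  apply/subsetP=> e /setDP[eE eJ].
  (* By maximality of [J], some [A] inside [e |: J] violates the count; it contains [e], and
     dropping [e] costs only one element, so [A] is tight. *)
  have : ~~ P (e |: J).
    apply/negP=> /maxJ/(_ (subsetUr _ _)) h.
    by move: eJ; rewrite -h setU11.
  rewrite /P subUset sub1set eE sJ /= => /forallPn[A].
  rewrite negb_imply -ltnNge => /andP[sA hA].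
  have eA : e \in A.
    apply/negPn/negP=> eA; have /hJ' : A \subset J; last lia.
    apply/subsetP=> x xA; have := subsetP sA x xA; rewrite !inE => /orP[/eqP xe|//].
    by rewrite xe (negPf eA) in xA.
  have AJ : A :&: J = A :\ e.
    apply/setP=> x; rewrite !inE andbC; case xA : (x \in A); last by rewrite !andbF.
    have := subsetP sA x xA; rewrite !inE andbT andbT.
    by case: eqVneq => [->|//]; rewrite (negPf eJ).
  have tA : tight A.
    rewrite /tight AJ; apply/andP; split.
      by apply: subset_trans sA _; rewrite subUset sub1set eE.
    by move: hA; rewrite (cardsD1 e A) eA; lia.
  by rewrite -(maxC _ (tU _ _ tC tA) (subsetUl _ _)) inE eA orbT.
have [sC tC'] := andP tC.
have := hE C sC.
have -> : E :\: C = J :\: C.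
  apply/setP=> x; rewrite !inE; case xC : (x \in C) => //=.
  apply/idP/idP; last exact: (subsetP sJ).
  by move=> xE; apply/negPn/negP=> xJ; have := subsetP EJC x; rewrite !inE xE xJ xC; move/(_ isT).
rewrite cardsD setIC => hC.
have sCJ : #|C :&: J| <= #|J| by apply: subset_leq_card; apply: subsetIr.
have [] := @extend_two_independent J set0 set0; rewrite -?setI_eq0 ?setI0 //.
  by move=> A sA; rewrite !setU0 cards0; have := hJ' _ sA; lia.
move=> I1 [I2 []]; rewrite !setU0 => hU d i1 i2; exists I1, I2; split=> //.
- by rewrite hU.
- by have := (leq_card_setU I1 I2).1; rewrite hU; lia.
Qed.
End Packing.

(** * Orientations with prescribed in-degrees *)

Section Orientation.
Variable V : finType.
Implicit Types (H : {set {set V}}) (W A B S X : {set V}).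

Definition induced H W := [set e in H | e \subset W].

Lemma induced_supermodular H A B :
  #|induced H A| + #|induced H B| <= #|induced H (A :|: B)| + #|induced H (A :&: B)|.
Proof.
rewrite -cardsUI; apply: leq_add; apply: subset_leq_card.
  apply/subsetP=> e; rewrite !inE => /orP[] /andP[-> h] /=.
    exact: subset_trans h (subsetUl _ _).
  exact: subset_trans h (subsetUr _ _).
by apply/subsetP=> e; rewrite !inE subsetI => /andP[/andP[-> ->] /andP[_ ->]].
Qed.

(** Hakimi's theorem. An edge [e] may receive the head [x], spending one unit of [m x], unless [x]
    lies in a tight set of the remaining edges. If both ends lie in tight sets, the union of these
    contains [e], and by supermodularity the bound fails on their union or their intersection. *)
Lemma orientation_in_degree_le (v0 : V) (m : V -> nat) H :
  {in H, forall e : {set V}, #|e| = 2} ->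
  (forall W, #|induced H W| <= \sum_(v in W) m v) ->
  exists head : {set V} -> V, {in H, forall e : {set V}, head e \in e} /\
    forall v, #|[set e in H | head e == v]| <= m v.
Proof.
elim: {H}_.+1 {-2}H (ltnSn #|H|) m => // n IHn H ltH m H2 hm.
have [->|[e eH]] := set_0Vmem H.
  exists (fun=> v0); split=> [e|v]; first by rewrite inE.
  by rewrite (_ : [set e in _ | _] = set0) ?cards0 //; apply/setP=> x; rewrite !inE.
have lt' : #|H :\ e| < n by rewrite (cardsD1 e) eH in ltH; lia.
pose tight x := [exists W : {set V}, (x \in W) && (\sum_(v in W) m v <= #|induced (H :\ e) W|)].
have key x : x \in e -> ~~ tight x -> exists head : {set V} -> V,
    {in H, forall e : {set V}, head e \in e} /\ forall v, #|[set e in H | head e == v]| <= m v.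
  move=> xe /existsPn tx.
  have tx' W : x \in W -> #|induced (H :\ e) W| < \sum_(v in W) m v.
    by move=> xW; have := tx W; rewrite xW /= -ltnNge.
  have mx : 0 < m x.
    have := tx' [set x] (set11 x); rewrite big_set1; exact: leq_trans.
  have [] := IHn (H :\ e) lt' (fun v => m v - (v == x)).
  - by move=> f /setD1P[_]; apply: H2.
  - move=> W; have [xW|xW] := boolP (x \in W).
      have := tx' W xW; rewrite !(bigD1 x xW) /= eqxx.
      rewrite (eq_bigr (fun v => m v - (v == x))); first by lia.
      by move=> v /andP[_ /negPf->]; rewrite subn0.
    rewrite (eq_bigr m); last first.
      by move=> v vW; case: eqVneq vW => [->|]; rewrite ?(negPf xW) ?subn0.
    apply: leq_trans (hm W); apply: subset_leq_card.
    by apply/subsetP=> f; rewrite !inE => /andP[/andP[_ ->] ->].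
  move=> hd [hd1 hd2]; exists (fun f => if f == e then x else hd f); split.
    by move=> f fH; case: eqVneq => [->//|fe]; apply: hd1; rewrite !inE fe.
  move=> v; have := hd2 v; have [->|vx] := eqVneq v x => h.
    have : [set f in H | (if f == e then x else hd f) == x] \subset
        e |: [set f in H :\ e | hd f == x].
      by apply/subsetP=> f; rewrite !inE; have [->|fe] := eqVneq f e.
    by move/subset_leq_card; rewrite cardsU1; move: h mx; case: (e \notin _); clear; lia.
  rewrite subn0 in h; apply: leq_trans h; apply: subset_leq_card.
  apply/subsetP=> f; rewrite !inE; have [->|_] //= := eqVneq f e.
  by rewrite eq_sym (negPf vx) andbF.
have /eqP/cards2P[u [w [uw ee]]] := H2 e eH.
have [tu|] := boolP (tight u); last by apply: key; rewrite ee !inE eqxx.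
have [tw|] := boolP (tight w); last by apply: key; rewrite ee !inE eqxx orbT.
have /existsP[W1 /andP[uW1 h1]] := tu.
have /existsP[W2 /andP[uW2 h2]] := tw.
have s := induced_supermodular (H :\ e) W1 W2.
have eU : induced H (W1 :|: W2) = e |: induced (H :\ e) (W1 :|: W2).
  apply/setP=> f; rewrite !inE; case: eqVneq => //= ->; rewrite eH /=.
  by rewrite ee subUset !sub1set !inE uW1 uW2 orbT.
have c1 : #|induced (H :\ e) (W1 :|: W2)| < #|induced H (W1 :|: W2)|.
  by rewrite eU cardsU1 !inE eqxx.
have c2 : #|induced (H :\ e) (W1 :&: W2)| <= #|induced H (W1 :&: W2)|.
  apply: subset_leq_card; apply/subsetP=> f.
  by rewrite !inE => /andP[/andP[_ ->] ->].
have k1 := hm (W1 :|: W2); have k2 := hm (W1 :&: W2).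
have mod : \sum_(v in W1 :|: W2) m v + \sum_(v in W1 :&: W2) m v
   = \sum_(v in W1) m v + \sum_(v in W2) m v.
  rewrite [LHS]addnC [\sum_(v in W1) m v](big_setID W2) /=.
  rewrite -addnA; congr (_ + _).
  rewrite (big_setID W2) /= addnC; congr (_ + _);
    by apply: eq_bigl => v; rewrite !inE; case: (v \in W2); rewrite ?orbT ?orbF ?andbF.
by move: s h1 h2 c1 c2 k1 k2 mod; clear; lia.
Qed.

(** The capacity is [kappa] on [P], lowered by [beta] on [R]; its total is [#|H|], so all in-degree
    bounds are attained. Edges with head in [X] lie inside [W = (X :|: S) :&: P], and comparing the
    in-degree sum over [X] with the sparsity of [W] gives the inequality. *)
Lemma rooted_orientation (v0 : V) (P R : {set V}) H (kappa beta s0 : nat) :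
  {in H, forall e : {set V}, #|e| = 2} -> {in H, forall e : {set V}, e \subset P} -> R \subset P ->
  beta <= kappa -> s0 + beta <= kappa.+1 ->
  #|H| + beta * #|R| = kappa * #|P| ->
  (forall W, W \subset P -> s0 <= #|W| ->
     #|induced H W| + beta * #|R| <= kappa * #|W|) ->
  exists head : {set V} -> V, {in H, forall e : {set V}, head e \in e} /\
    forall S X, X :&: P != set0 ->
      {in H, forall e : {set V}, head e \in X -> e \subset X :|: S} ->
      beta * #|R| <= kappa * #|S| + beta * #|R :&: X|.
Proof.
move=> H2 HP RP bk s0k cH hW.
pose m v := (v \in P) * (kappa - (v \in R) * beta).
have sm W : \sum_(v in W) m v + beta * #|R :&: W| = kappa * #|P :&: W|.
  have cI A : #|A :&: W| = \sum_(v in W | v \in A) 1.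
    by rewrite -sum1_card; apply: eq_bigl => v; rewrite inE andbC.
  rewrite !cI !big_distrr /= !muln1.
  rewrite !big_mkcondr /= -big_split /=; apply: eq_bigr => v vW; rewrite /m.
  have := subsetP RP v; case: (v \in R) => [/(_ isT)->|_]; last first.
    by rewrite mul0n subn0 addn0; case: (v \in P); rewrite ?mul1n.
  by rewrite !mul1n; lia.
have iP W : induced H W = induced H (W :&: P).
  by apply/setP=> e; rewrite !inE subsetI; case eH: (e \in H) => //=; rewrite HP // andbT.
have hm W : #|induced H W| <= \sum_(v in W) m v.
  have := sm W; have RW : #|R :&: W| <= #|W :&: P|.
    by apply: subset_leq_card; rewrite setIC setIS.
  have RR : beta * #|R :&: W| <= beta * #|R|.
    by rewrite leq_mul2l subset_leq_card ?orbT // subsetIl.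
  rewrite iP [P :&: W]setIC; have [ge|lt] := leqP s0 #|W :&: P|.
    by have := hW _ (subsetIr W P) ge; move: RR; clear; lia.
  (* Below [s0] vertices sparsity is not assumed, but a set of [w] vertices spans at most
     [w * (w - 1)] edges, and [w - 1 <= kappa - beta]. *)
  have : #|induced H (W :&: P)| <= 'C(#|W :&: P|, 2).
    rewrite -(cards_draws (W :&: P)); apply: subset_leq_card.
    by apply/subsetP=> e; rewrite !inE => /andP[eH ->]; rewrite H2.
  have : 'C(#|W :&: P|, 2) <= #|W :&: P| * #|W :&: P|.-1.
    by rewrite bin2 -divn2 leq_div.
  move: RW lt; move: #|W :&: P| #|R :&: W| => w r rw lt le1 le2 eqs.
  have : w * w.-1 + beta * r <= kappa * w; last by lia.
  have : w * w.-1 + beta * w <= kappa * w.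
    by rewrite [beta * w]mulnC -mulnDr [kappa * w]mulnC leq_mul2l; apply/orP; right; lia.
  by apply: leq_trans; rewrite leq_add2l leq_mul2l rw orbT.
have [hd [hd1 hd2]] := orientation_in_degree_le v0 H2 hm.
exists hd; split=> // S X XP hX.
have le_in A : #|[set e in H | hd e \in A]| <= \sum_(v in A) m v.
  rewrite -sum1_card (partition_big hd (mem A)) /=; last by move=> e; rewrite inE => /andP[].
  apply: leq_sum => v vA; apply: leq_trans (hd2 v); rewrite -sum1_card.
  apply/eq_leq/eq_bigl => e; rewrite !inE.
  by case: (eqVneq (hd e) v) => [->|]; rewrite ?vA ?andbF ?andbT.
(* The capacities sum to [#|H|], so the upper bound on the complement of [A] becomes a lower bound
   on [A]. *)
have ge_in A : \sum_(v in A) m v <= #|[set e in H | hd e \in A]|.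
  have h1 := le_in (~: A); have h2 := sm A; have h3 := sm (~: A).
  have h4 : #|[set e in H | hd e \in A]| + #|[set e in H | hd e \in ~: A]| = #|H|.
    rewrite -(cardsID [set e | hd e \in A] H); congr (_ + _).
      by apply: eq_card => e; rewrite !inE.
    by apply: eq_card => e; rewrite !inE andbC.
  have h5 := cardsID A P; have h6 := cardsID A R; rewrite !setDE in h5 h6.
  have h7 : kappa * #|P :&: A| + kappa * #|P :&: ~: A| = kappa * #|P|.
    by rewrite -mulnDr h5.
  have h8 : beta * #|R :&: A| + beta * #|R :&: ~: A| = beta * #|R|.
    by rewrite -mulnDr h6.
  by move: h1 h2 h3 h4 h7 h8 cH; clear; lia.
set W := (X :|: S) :&: P.
have [ge|lt] := leqP s0 #|W|.
  have h1 := ge_in X; have h2 := sm X; have h3 := hW W (subsetIr _ _) ge.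
  have h4 : #|[set e in H | hd e \in X]| <= #|induced H W|.
    apply: subset_leq_card; apply/subsetP=> e; rewrite !inE => /andP[eH hx].
    by rewrite eH subsetI hX // HP.
  have h5 : kappa * #|W| <= kappa * #|P :&: X| + kappa * #|S|.
    rewrite -mulnDr leq_mul2l; apply/orP; right.
    apply: leq_trans (leq_card_setU _ _).1; apply: subset_leq_card.
    by apply/subsetP=> v; rewrite !inE => /andP[/orP[]-> ->]; rewrite ?orbT.
  by move: h1 h2 h3 h4 h5; clear; lia.
(* A [W] with fewer than [s0] vertices is impossible: the in-degree of [x] is at least
   [kappa - beta >= s0 - 1], yet its in-neighbours lie in [W :\ x]. *)
have [x /setIP[xX xP]] := set0Pn _ XP.
have xW : x \in W by rewrite !inE xX xP.
have := ge_in [set x]; rewrite big_set1 => h1.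
have h2 : #|[set e in H | hd e \in [set x]]| <= #|W :\ x|.
  have : [set e in H | hd e \in [set x]] \subset [set [set x; y] | y in W :\ x].
    apply/subsetP=> e; rewrite !inE => /andP[eH /eqP hx].
    have /eqP/cards2P[u [w [uw ee]]] := H2 e eH.
    have eW : e \subset W by rewrite subsetI HP // hX // hx.
    have := hd1 e eH; rewrite hx ee !inE => /orP[] /eqP xe; apply/imsetP.
      exists w; last by rewrite xe.
      by rewrite !inE xe eq_sym uw /= -in_setU -in_setI (subsetP eW) // ee !inE eqxx orbT.
    exists u; last by rewrite xe setUC.
    by rewrite !inE xe uw /= -in_setU -in_setI (subsetP eW) // ee !inE eqxx.
  by move/subset_leq_card/leq_trans; apply; apply: leq_imset_card.
have h3 : kappa - beta <= m x by rewrite /m xP; case: (x \in R); lia.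
rewrite (cardsD1 x W) xW in lt; exfalso.
by move: h1 h2 h3 lt s0k bk; clear; lia.
Qed.
End Orientation.

(** * Generic configurations *)

Section Semicontinuity.
Local Open Scope ring_scope.

(** An invertible compression [X *m A0 *m Y], of size the rank at [t0], stays invertible wherever
    its determinant, a polynomial in [t], does not vanish. *)
Lemma rank_horner_semicontinuous (F : fieldType) m n (A : 'M[{poly F}]_(m, n)) (t0 : F) :
  exists2 f : {poly F}, f != 0 & forall t, f.[t] != 0 ->
    (\rank (map_mx (horner_eval t0) A) <= \rank (map_mx (horner_eval t) A))%N.
Proof.
set A0 := map_mx _ A; set r := \rank A0.
pose X : 'M[F]_(r, m) := pid_mx r *m invmx (col_ebase A0).
pose Y : 'M[F]_(n, r) := invmx (row_ebase A0) *m pid_mx r.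
have XY : X *m A0 *m Y = 1%:M.
  rewrite -[A0]mulmx_ebase /X /Y !mulmxA mulmxKV ?col_ebase_unit //.
  rewrite -!mulmxA (mulmxA (row_ebase A0)) mulmxV ?row_ebase_unit // mul1mx.
  by rewrite !mulmxA !pid_mx_id ?rank_leq_row ?rank_leq_col ?pid_mx_1.
clearbody X Y.
pose f := \det (map_mx polyC X *m A *m map_mx polyC Y).
have fE t : f.[t] = \det (X *m map_mx (horner_eval t) A *m Y).
  rewrite -[f.[t]]/(horner_eval t f) /f -det_map_mx !map_mxM -!map_mx_comp.
  by congr (\det (_ *m _ *m _)); apply/matrixP=> i j; rewrite !mxE /= /horner_eval hornerC.
have f0 : f != 0.
  apply/eqP=> f0; have := fE t0; rewrite XY det1 f0 horner0 => /eqP.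
  by rewrite eq_sym oner_eq0.
exists f => // t ft.
have : X *m map_mx (horner_eval t) A *m Y \in unitmx by rewrite unitmxE -fE unitfE.
move/mxrank_unit => {1}<-; apply: leq_trans (mxrankM_maxl _ _) _.
exact: mxrankM_maxr.
Qed.

Lemma poly_nonroot (f : {poly rat}) : f != 0 -> exists t, f.[t] != 0.
Proof.
move=> f0; apply: NNPP => h.
have hr : all (root f) [seq i%:R | i <- iota 0 (size f)].
  by apply/allP=> t _; apply/eqP; apply: NNPP => ht; apply: h; exists t; apply/eqP.
have := max_poly_roots f0 hr; rewrite map_inj_uniq ?iota_uniq; last first.
  by move=> i j /eqP; rewrite eqr_nat => /eqP.
by rewrite size_map size_iota ltnn => /(_ isT).
Qed.

Lemma poly_family_nonroot (I : finType) (f : I -> {poly rat}) :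
  (forall i, f i != 0) -> exists t, forall i, (f i).[t] != 0.
Proof.
move=> f0; have [|t ht] := @poly_nonroot (\prod_i f i).
  by apply/prodf_neq0 => i _.
exists t => i; move: ht; rewrite horner_prod => /prodf_neq0; exact.
Qed.
End Semicontinuity.

(** If some [p'] beats [p] at an index, a common dominator of both has a smaller total deficit
    [\sum_i (b - rk p i)], which cannot decrease forever. *)
Lemma exists_common_maximizer (C : Type) (I : finType) (rk : C -> I -> nat) (b : nat) (p0 : C) :
  (forall p i, rk p i <= b) ->
  (forall p p', exists p'', forall i, rk p i <= rk p'' i /\ rk p' i <= rk p'' i) ->
  exists p, forall p' i, rk p' i <= rk p i.
Proof.
move=> hb hj.
suff gen k p : \sum_i (b - rk p i) <= k -> exists p, forall p' i, rk p' i <= rk p i.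
  exact: (gen _ p0 (leqnn _)).
elim: k p => [|k IHk] p hp.
  exists p => p' i; move: hp; rewrite leqn0 sum_nat_eq0 => /forallP/(_ i) /= h.
  by have := hb p' i; lia.
apply: NNPP => hn; apply: (hn); apply: NNPP => _.
have [p' [i lt]] : exists p' i, rk p i < rk p' i.
  apply: NNPP => h; apply: hn; exists p => p' i; rewrite leqNgt; apply/negP=> lt.
  by apply: h; exists p', i.
have [p'' hp''] := hj p p'; apply: hn; apply: (IHk p'').
rewrite -ltnS; apply: leq_trans hp; rewrite (bigD1 i) //= [X in _ < X](bigD1 i) //=.
rewrite -addSn leq_add //.
  by have := hp'' i; have := hb p'' i; lia.
by apply: leq_sum => j _; have := (hp'' j).1; lia.
Qed.

Section RigidityMatrix.
Local Open Scope ring_scope.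
Variables (V : finType) (d : nat).
Implicit Types (p : V -> 'I_d -> rat) (F : {set {set V}}) (v x y : V) (S T : {set V}).

(* This form of the rigidity row is symmetric in its endpoints, so it depends on the edge only. *)
Definition rigidity_row p x y : 'rV[rat]_(#|{: V * 'I_d}|) :=
  \row_j ((((enum_val j).1 == x)%:R - ((enum_val j).1 == y)%:R) *
          (p x (enum_val j).2 - p y (enum_val j).2)).

(** Rows range over all ordered pairs and vanish outside [F], so that the shape is the same for
    every [F]. *)
Definition rigidity_mx p F : 'M[rat]_(#|{: V * V}|, #|{: V * 'I_d}|) :=
  \matrix_(k, j) (if [set (enum_val k).1; (enum_val k).2] \in F
    then rigidity_row p (enum_val k).1 (enum_val k).2 0 j else 0).

Definition rigidity_rank p F := \rank (rigidity_mx p F).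

(** For [v] outside [T], full row rank says that the points of [v |: T] are affinely independent. *)
Definition difference_mx p v T : 'M[rat]_(#|T|, d) :=
  \matrix_(k, i) (p v i - p (enum_val k) i).

(** Simultaneous maximality of finitely many ranks stands in for algebraic independence of the
    coordinates. *)
Definition generic p := forall p',
  (forall F, rigidity_rank p' F <= rigidity_rank p F)%N /\
  (forall v T, \rank (difference_mx p' v T) <= \rank (difference_mx p v T))%N.

Lemma exists_line_point m n (A B : 'M[rat]_(m, n)) :
  exists2 f : {poly rat}, f != 0 & forall t, f.[t] != 0 ->
    (\rank A <= \rank ((1 - t) *: A + t *: B)%R /\
     \rank B <= \rank ((1 - t) *: A + t *: B)%R)%N.
Proof.
pose P : 'M[{poly rat}]_(m, n) := \matrix_(i, j) ((1 - 'X) * (A i j)%:P + 'X * (B i j)%:P).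
have PE t : map_mx (horner_eval t) P = (1 - t) *: A + t *: B.
  by apply/matrixP=> i j; rewrite !mxE /= /horner_eval !hornerE.
have [f0 f0N h0] := rank_horner_semicontinuous P 0.
have [f1 f1N h1] := rank_horner_semicontinuous P 1.
exists (f0 * f1) => [|t]; first by rewrite mulf_neq0.
rewrite hornerM mulf_eq0 negb_or => /andP[/h0 k0 /h1 k1].
move: k0 k1; rewrite !PE subr0 subrr !scale0r !scale1r addr0 add0r.
by split.
Qed.

(** Both kinds of matrices are linear in the configuration, so a point on the line through two
    configurations that avoids the roots of finitely many polynomials dominates both in every
    rank. *)
Lemma exists_generic : exists p, generic p.
Proof.
pose I : finType := ({set {set V}} + V * {set V})%type.
pose rk p (i : I) := match i with inl F => rigidity_rank p F
  | inr vT => \rank (difference_mx p vT.1 vT.2) end.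
have [] := @exists_common_maximizer (V -> 'I_d -> rat) I rk (#|{: V * 'I_d}| + d)%N (fun _ _ => 0).
- move=> p [F|[v T]] /=.
    by apply: leq_trans (rank_leq_col _) _; apply: leq_addr.
  by apply: leq_trans (rank_leq_col _) _; apply: leq_addl.
- move=> p p'; pose line t x i := (1 - t) * p x i + t * p' x i.
  have hf (i : I) : exists2 f : {poly rat}, f != 0 & forall t, f.[t] != 0 ->
      (rk p i <= rk (line t) i /\ rk p' i <= rk (line t) i)%N.
    case: i => [F|[v T]] /=.
      have [f f0 hf] := exists_line_point (rigidity_mx p F) (rigidity_mx p' F).
      exists f => // t /hf; rewrite /rigidity_rank.
      suff -> : rigidity_mx (line t) F = (1 - t) *: rigidity_mx p F + t *: rigidity_mx p' F by [].
      apply/matrixP=> k j; rewrite !mxE; case: ifP => _; last by rewrite !mulr0 addr0.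
      by rewrite /line; ring.
    have [f f0 hf] := exists_line_point (difference_mx p v T) (difference_mx p' v T).
    exists f => // t /hf.
    suff -> : difference_mx (line t) v T =
      (1 - t) *: difference_mx p v T + t *: difference_mx p' v T by [].
    by apply/matrixP=> k j; rewrite !mxE /line; ring.
  have hf' (i : I) : exists f : {poly rat}, f != 0 /\ forall t, f.[t] != 0 ->
      (rk p i <= rk (line t) i /\ rk p' i <= rk (line t) i)%N.
    by have [f ? ?] := hf i; exists f.
  have [f hf2] := fin_all_exists hf'.
  have [t ht] := @poly_family_nonroot I f (fun i => (hf2 i).1).
  by exists (line t) => i; apply: (hf2 i).2; apply: ht.
move=> p hp; exists p => p'; split=> [F|v T]; first exact: (hp p' (inl F)).
exact: (hp p' (inr (v, T))).
Qed.

Lemma generic_difference_free p v T : generic p -> v \notin T -> (#|T| <= d)%N ->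
  \rank (difference_mx p v T) = #|T|.
Proof.
move=> gp vT Td; apply/eqP; rewrite eqn_leq rank_leq_row /=.
(* Places [v] at the origin and the elements of [T] at the negatives of distinct unit vectors. *)
pose p' x (i : 'I_d) : rat := if x == v then 0 else - (i == index x (enum T) :> nat)%:R.
apply: leq_trans ((gp p').2 v T).
suff -> : difference_mx p' v T = pid_mx #|T| by rewrite rank_pid_mx.
apply/matrixP=> k i; rewrite !mxE /p' eqxx sub0r ifN; last first.
  by apply: contraNneq vT => <-; apply: enum_valP.
rewrite opprK ltn_ord andbT; congr (_%:R); congr nat_of_bool.
rewrite (enum_val_nth v) index_uniq ?enum_uniq // -?cardE //.
Qed.
End RigidityMatrix.

(** * The rigidity matroid *)

Lemma exists_subset_card (T : finType) (A : {set T}) n :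
  n <= #|A| -> exists2 B : {set T}, B \subset A & #|B| = n.
Proof.
move=> nA; exists [set x in take n (enum A)].
  by apply/subsetP=> x; rewrite inE => /mem_take; rewrite mem_enum.
rewrite cardsE (card_uniqP _) ?take_uniq ?enum_uniq // size_take -cardE.
by case: ltngtP nA.
Qed.

Lemma bin2_sum_square n : 'C(n.+1, 2) + 'C(n, 2) = n * n.
Proof. by elim: n => // n IHn; rewrite [in LHS]binS bin1; rewrite binS bin1 in IHn *; lia. Qed.

Section RigidityMatroid.
Local Open Scope ring_scope.
Variables (V : finType) (d : nat).
Implicit Types (p : V -> 'I_d -> rat) (F G : {set {set V}}) (v x y : V) (S T W : {set V}).

Lemma rigidity_row_sym p x y : rigidity_row p x y = rigidity_row p y x.
Proof. by apply/matrixP=> i j; rewrite !mxE; ring. Qed.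

Lemma rigidity_row_id p x : rigidity_row p x x = 0.
Proof. by apply/matrixP=> i j; rewrite !mxE; ring. Qed.

Lemma rigidity_row_sub p F x y :
  [set x; y] \in F -> (rigidity_row p x y <= rigidity_mx p F)%MS.
Proof.
move=> xyF; suff -> : rigidity_row p x y = row (enum_rank (x, y)) (rigidity_mx p F).
  exact: row_sub.
by apply/matrixP=> i j; rewrite !mxE enum_rankK xyF.
Qed.

Lemma rigidity_mx_subP p F m (U : 'M_(m, _)) :
  reflect (forall x y, [set x; y] \in F -> (rigidity_row p x y <= U)%MS) (rigidity_mx p F <= U)%MS.
Proof.
apply: (iffP idP) => [h x y xyF|h].
  exact: submx_trans (rigidity_row_sub _ xyF) h.
apply/row_subP=> k; have [xyF|xyF] := boolP ([set (enum_val k).1; (enum_val k).2] \in F).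
  suff -> : row k (rigidity_mx p F) = rigidity_row p (enum_val k).1 (enum_val k).2 by apply: h.
  by apply/matrixP=> i j; rewrite !mxE xyF.
suff -> : row k (rigidity_mx p F) = 0 by apply: sub0mx.
by apply/matrixP=> i j; rewrite !mxE (negPf xyF).
Qed.

Lemma rigidity_mxS p F G : F \subset G -> (rigidity_mx p F <= rigidity_mx p G)%MS.
Proof.
by move=> FG; apply/rigidity_mx_subP=> x y xyF; apply: rigidity_row_sub; apply: (subsetP FG).
Qed.

Lemma rigidity_rank_mono p F G : F \subset G -> (rigidity_rank p F <= rigidity_rank p G)%N.
Proof. by move=> FG; apply/mxrankS/rigidity_mxS. Qed.

(** The dimension formula for the sum and the intersection of the two row spaces; the latter
    contains the rows of [F :&: G]. *)
Lemma rigidity_rank_submodular p F G :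
  (rigidity_rank p (F :|: G) + rigidity_rank p (F :&: G) <=
   rigidity_rank p F + rigidity_rank p G)%N.
Proof.
rewrite /rigidity_rank -[leqRHS]mxrank_sum_cap; apply: leq_add; apply: mxrankS.
  apply/rigidity_mx_subP=> x y; rewrite inE => /orP[] h.
    exact: submx_trans (rigidity_row_sub _ h) (addsmxSl _ _).
  exact: submx_trans (rigidity_row_sub _ h) (addsmxSr _ _).
by rewrite sub_capmx !rigidity_mxS ?subsetIl ?subsetIr.
Qed.

Lemma set2_eq x y x' y' : [set x; y] = [set x'; y'] ->
  (x = x' /\ y = y') \/ (x = y' /\ y = x').
Proof.
move=> /setP h; have := h x; have := h y; have := h x'; have := h y'; rewrite !inE !eqxx ?orbT /=.
by do ![case: eqVneq => [->|?] //=]; auto.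
Qed.

Lemma rigidity_rank_setU1 p x y F :
  (rigidity_rank p ([set x; y] |: F) <= (rigidity_rank p F).+1)%N.
Proof.
have : (rigidity_mx p ([set x; y] |: F) <= rigidity_row p x y + rigidity_mx p F)%MS.
  apply/rigidity_mx_subP=> x' y'; rewrite !inE => /orP[/eqP/set2_eq h|h].
    by case: h => -[-> ->]; rewrite 1?rigidity_row_sym addsmxSl.
  exact: submx_trans (rigidity_row_sub _ h) (addsmxSr _ _).
move/mxrankS/leq_trans; apply; apply: leq_trans (mxrank_adds_leqif _ _).1 _.
by rewrite -[in leqRHS]add1n leq_add2r rank_leq_row.
Qed.

Lemma rigidity_rank_card p F : (rigidity_rank p F <= #|F|)%N.
Proof.
elim: {F}_.+1 {-2}F (ltnSn #|F|) => // n IHn F ltF.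
have [->|[e eF]] := set_0Vmem F.
  rewrite cards0 leqn0 mxrank_eq0; apply/eqP/matrixP=> i j.
  by rewrite !mxE inE.
have lt' : (#|F :\ e| < n)%N by rewrite (cardsD1 e) eF in ltF; lia.
rewrite -{1}(setD1K eF) [leqRHS](cardsD1 e) eF.
have [/existsP[x /existsP[y /eqP ee]]|he] := boolP [exists x, exists y, e == [set x; y]].
  rewrite {1}ee; apply: leq_trans (rigidity_rank_setU1 _ _ _ _) _.
  by rewrite ltnS IHn.
apply: (@leq_trans (rigidity_rank p (F :\ e))); last first.
  by apply: leq_trans (IHn _ lt') _; rewrite leq_addl.
apply/mxrankS/rigidity_mx_subP=> x y; rewrite 2!inE => /orP[/eqP xye|h]; last first.
  exact: rigidity_row_sub.
by case/negP: he; apply/existsP; exists x; apply/existsP; exists y; rewrite xye.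
Qed.

Definition block_mx_at v : 'M[rat]_(#|{: V * 'I_d}|, d) :=
  \matrix_(j, i) (enum_val j == (v, i))%:R.

Lemma mul_block_at v (z : 'rV_#|{: V * 'I_d}|) i :
  (z *m block_mx_at v) 0 i = z 0 (enum_rank (v, i)).
Proof.
rewrite mxE (bigD1 (enum_rank (v, i))) //= mxE enum_rankK eqxx mulr1 big1 ?addr0 //.
move=> j ji; rewrite mxE (_ : _ == _ = false) ?mulr0 //; apply: contraNF ji => /eqP<-.
by rewrite enum_valK.
Qed.

Lemma rigidity_row_block p v y : v != y ->
  rigidity_row p v y *m block_mx_at v = \row_i (p v i - p y i).
Proof.
move=> vy; apply/rowP=> i; rewrite mul_block_at !mxE enum_rankK /= eqxx (negPf vy).
by rewrite subr0 mul1r.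
Qed.

Lemma rigidity_row_block0 p v x y : v != x -> v != y ->
  rigidity_row p x y *m block_mx_at v = 0.
Proof.
move=> vx vy; apply/rowP=> i; rewrite mul_block_at !mxE enum_rankK /= (negPf vx) (negPf vy).
by rewrite subr0 mul0r.
Qed.

Definition star v T : {set {set V}} := [set [set v; x] | x in T].

Lemma mem_star v x T : x \in T -> [set v; x] \in star v T.
Proof. exact: imset_f. Qed.

Definition avoids v F := forall e, e \in F -> v \notin e.

(** Rank-nullity for the projection to the [d] coordinates of [v]: rows of edges avoiding [v] lie in
    its kernel, those of [B] in its image. Two configurations are allowed because edge splitting
    moves [v]. *)
Lemma rank_block_extension v p F m (B : 'M[rat]_(m, d)) F' p' :
  avoids v F -> (rigidity_mx p' F <= rigidity_mx p F')%MS ->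
  (B <= rigidity_mx p F' *m block_mx_at v)%MS ->
  (rigidity_rank p' F + \rank B <= rigidity_rank p F')%N.
Proof.
move=> vF FF' BF'.
rewrite /rigidity_rank -[leqRHS](mxrank_mul_ker _ (block_mx_at v)) addnC.
apply: leq_add; first exact: mxrankS.
apply: mxrankS; rewrite sub_capmx FF'; apply/rigidity_mx_subP=> x y xyF.
have := vF _ xyF; rewrite !inE negb_or => /andP[vx vy].
by apply/sub_kermxP; apply: rigidity_row_block0.
Qed.

Lemma rank_star_extension p v T F : generic p -> avoids v F -> v \notin T -> (#|T| <= d)%N ->
  (rigidity_rank p F + #|T| <= rigidity_rank p (F :|: star v T))%N.
Proof.
move=> gp vF vT Td; rewrite -(generic_difference_free gp vT Td).
apply: (@rank_block_extension v) => //; first by rewrite rigidity_mxS // subsetUl.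
apply/row_subP=> k; have kT := enum_valP k.
have vk : v != enum_val k by apply: contraNneq vT => ->.
have -> : row k (difference_mx p v T) = rigidity_row p v (enum_val k) *m block_mx_at v.
  by rewrite rigidity_row_block //; apply/rowP=> i; rewrite !mxE.
by apply/submxMr/rigidity_row_sub; rewrite inE mem_star ?orbT.
Qed.

(** Edge splitting. With [v] moved to the midpoint of [u] and [w], the row of [u w] is twice the sum
    of the rows of [v u] and [v w], and differences of rows at [v] project onto
    [difference_mx p u (T :\ u)], of rank [d]. Genericity transfers the bound back to [p]. *)
Lemma rank_edge_split p v u w T F : generic p -> avoids v F -> v \notin T ->
  u \in T -> w \in T -> u != w -> #|T| = d.+1 ->
  (rigidity_rank p ([set u; w] |: F) + d <= rigidity_rank p (F :|: star v T))%N.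
Proof.
move=> gp vF vT uT wT uw cT.
have vx x : x \in T -> (x == v) = false by move=> xT; apply: contraNF vT => /eqP<-.
pose p' x i : rat := if x == v then (p u i + p w i) / 2%:R else p x i.
have p'v i : p' v i = (p u i + p w i) / 2%:R by rewrite /p' eqxx.
have p'T x i : x \in T -> p' x i = p x i by move=> xT; rewrite /p' vx.
apply: leq_trans ((gp p').1 _).
have cTu : #|T :\ u| = d by move: cT; rewrite (cardsD1 u) uT => -[].
rewrite -[X in (_ + X)%N]cTu -(@generic_difference_free _ _ p u (T :\ u)) ?cTu // ?inE ?eqxx //.
apply: (@rank_block_extension v).
- move=> e; rewrite !inE => /orP[/eqP->|/vF //]; rewrite !inE ![v == _]eq_sym.
  by rewrite !vx.
- have star_sub x : x \in T -> (rigidity_row p' v x <= rigidity_mx p' (F :|: star v T))%MS.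
    by move=> xT; apply/rigidity_row_sub; rewrite inE mem_star ?orbT.
  apply/rigidity_mx_subP=> x y; rewrite !inE => /orP[/eqP xy|xyF].
    have -> : rigidity_row p x y = 2%:R *: (rigidity_row p' v u + rigidity_row p' v w).
      have -> : rigidity_row p x y = rigidity_row p u w.
        by case: (set2_eq xy) => -[-> ->] //; rewrite rigidity_row_sym.
      by apply/rowP=> j; rewrite !mxE p'v !p'T //; field.
    by apply/scalemx_sub/addmx_sub; apply: star_sub.
  have -> : rigidity_row p x y = rigidity_row p' x y.
    have := vF _ xyF; rewrite !inE negb_or ![v == _]eq_sym => /andP[/negPf vx' /negPf vy'].
    by apply/rowP=> j; rewrite !mxE /p' vx' vy'.
  by apply: rigidity_row_sub; rewrite inE xyF.
apply/row_subP=> k; have := enum_valP k; rewrite !inE => /andP[ku kT].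
have vu' : v != u by rewrite eq_sym vx.
have vk : v != enum_val k by rewrite eq_sym vx.
have -> : row k (difference_mx p u (T :\ u)) =
    (rigidity_row p' v (enum_val k) - rigidity_row p' v u) *m block_mx_at v.
  rewrite mulmxBl !rigidity_row_block //; apply/rowP=> i; rewrite !mxE.
  by rewrite (p'T u) ?(p'T (enum_val k)) //; ring.
apply/submxMr; rewrite addmx_sub ?eqmx_opp ?rigidity_row_sub // inE mem_star ?orbT //.
Qed.

Lemma exists_difference_dependency p v T : (d < #|T|)%N ->
  exists c : V -> rat, (exists2 x, x \in T & c x != 0) /\
    forall i, \sum_(x in T) c x * (p v i - p x i) = 0.
Proof.
move=> dT; have : kermx (difference_mx p v T) != 0.
  rewrite -mxrank_eq0 mxrank_ker subn_eq0 -ltnNge.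
  exact: leq_ltn_trans (rank_leq_col _) dT.
case/rowV0Pn=> b /sub_kermxP bD /rV0Pn[k bk].
pose c x := \sum_(k | enum_val k == x) b 0 k.
have cE j : c (enum_val j) = b 0 j.
  by rewrite /c (big_pred1 j) // => j'; rewrite (inj_eq enum_val_inj).
exists c; split; first by exists (enum_val k); [exact: enum_valP|rewrite cE].
move=> i; have := congr1 (fun M : 'rV_d => M 0 i) bD; rewrite !mxE => h; apply: etrans h.
by rewrite big_enum_val; apply: eq_bigr => j _; rewrite cE mxE.
Qed.

Lemma generic_difference_indep p v T (c : V -> rat) : generic p -> v \notin T -> (#|T| <= d)%N ->
  (forall i, \sum_(x in T) c x * (p v i - p x i) = 0) -> {in T, forall x, c x = 0}.
Proof.
move=> gp vT Td h x xT.
have fr : row_free (difference_mx p v T) by rewrite /row_free generic_difference_free.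
have : (\row_k c (enum_val k)) *m difference_mx p v T == 0.
  apply/eqP/rowP=> i; rewrite !mxE; apply: etrans (h i); rewrite [RHS]big_enum_val.
  by apply: eq_bigr => k _; rewrite !mxE.
rewrite mulmx_free_eq0 // => /eqP/rowP/(_ (enum_rank_in xT x)).
by rewrite !mxE enum_rankK_in.
Qed.

(* An affine dependency lam of d+2 points yields the equilibrium stress lam_x lam_y. *)
Lemma clique_closure p v w T m (U : 'M[rat]_(m, _)) : generic p -> v != w ->
  v \notin T -> w \notin T -> #|T| = d ->
  {in w |: T &, forall x y, (rigidity_row p x y <= U)%MS} ->
  {in T, forall x, (rigidity_row p v x <= U)%MS} ->
  (rigidity_row p v w <= U)%MS.
Proof.
move=> gp vw vT wT cT hK hv.
have vwT : v \notin w |: T by rewrite !inE negb_or vw vT.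
have cwT : #|w |: T| = d.+1 by rewrite cardsU1 wT cT.
have [c [[x0 x0T cx0] hc]] := @exists_difference_dependency p v (w |: T) (eq_leq (esym cwT)).
(* The points of [v |: T] are affinely independent, so the dependency must involve [w]. *)
have cw : c w != 0.
  apply/eqP=> cw; have h i : \sum_(x in T) c x * (p v i - p x i) = 0.
    by have := hc i; rewrite big_setU1 //= cw mul0r add0r.
  move: x0T cx0; rewrite !inE => /orP[/eqP->|x0T]; first by rewrite cw eqxx.
  by rewrite (generic_difference_indep gp vT _ h) ?eqxx ?cT.
pose s := \sum_(x in w |: T) c x.
(* If [s] were zero, the relation could be based at [w], where its [w] term disappears; independence
   of [w |: T] then kills [c] on [T], leaving [s = c w]. *)
have s0 : s != 0.
  apply/eqP=> s0; have h i : \sum_(x in T) c x * (p w i - p x i) = 0.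
    have : \sum_(x in w |: T) c x * (p w i - p x i) =
        \sum_(x in w |: T) c x * (p v i - p x i) + s * (p w i - p v i).
      by rewrite /s mulr_suml -big_split; apply: eq_bigr => x _ /=; ring.
    by rewrite hc s0 mul0r addr0 big_setU1 //= subrr mulr0 add0r.
  have cT0 := generic_difference_indep gp wT (eq_leq cT) h.
  move: s0; rewrite /s big_setU1 //= big1 ?addr0; first by move/eqP; apply/negP.
  by move=> x /cT0.
(* The weight of [v] makes all weights sum to zero, turning the relation into an affine dependency
   on [Z]. *)
pose lam x := if x == v then - s else c x.
pose Z := v |: (w |: T).
have lamZ x : x \in w |: T -> lam x = c x.
  by rewrite /lam; case: eqVneq => // ->; rewrite (negPf vwT).
have lam_sum : \sum_(x in Z) lam x = 0.
  rewrite big_setU1 //= (eq_bigr c) => [|x xT]; last exact: lamZ.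
  by rewrite /lam eqxx addNr.
have lam_pos i : \sum_(x in Z) lam x * p x i = 0.
  rewrite big_setU1 //= (eq_bigr (fun x => c x * p x i)) => [|x xT]; last by rewrite lamZ.
  rewrite /lam eqxx /s mulNr mulr_suml addrC -sumrB.
  apply/eqP; rewrite -oppr_eq0 -sumrN; apply/eqP; apply: etrans (hc i).
  by apply: eq_bigr => x _; ring.
have lam_diff x i : \sum_(y in Z) lam y * (p x i - p y i) = 0.
  rewrite (eq_bigr (fun y => lam y * p x i - lam y * p y i)) => [|y _]; last by ring.
  by rewrite sumrB lam_pos subr0 -mulr_suml lam_sum mul0r.
have stress : \sum_(x in Z) \sum_(y in Z) (lam x * lam y) *: rigidity_row p x y = 0.
  apply/rowP=> j; rewrite mxE summxE; set z := (enum_val j).1; set i := (enum_val j).2.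
  transitivity (\sum_(x in Z) lam x * (z == x)%:R * (\sum_(y in Z) lam y * (p x i - p y i)) +
      \sum_(y in Z) lam y * (z == y)%:R * (\sum_(x in Z) lam x * (p y i - p x i))).
    rewrite [X in _ = _ + X](eq_bigr (fun y => \sum_(x in Z) lam y * (z == y)%:R *
      (lam x * (p y i - p x i)))) => [|y _]; last by rewrite mulr_sumr.
    rewrite [X in _ = _ + X]exchange_big /= -big_split; apply: eq_bigr => x _ /=.
    rewrite mulr_sumr -big_split summxE; apply: eq_bigr => y _ /=.
    by rewrite !mxE -/z -/i; ring.
  by rewrite !big1 ?addr0 // => x _; rewrite lam_diff mulr0.
(* The factor two accounts for both orders of the pair [v], [w] in the double sum. *)
have lvw : lam v * lam w * 2%:R != 0.
  by rewrite (lamZ w) ?setU11 // /lam eqxx !mulf_neq0 // oppr_eq0.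
suff : ((lam v * lam w * 2%:R) *: rigidity_row p v w <= U)%MS.
  by rewrite (eqmx_scale _ lvw).
have -> : (lam v * lam w * 2%:R) *: rigidity_row p v w =
  - (\sum_(x in T) (lam v * lam x) *: rigidity_row p v x +
     \sum_(x in T) (lam x * lam v) *: rigidity_row p x v +
     \sum_(x in w |: T) \sum_(y in w |: T) (lam x * lam y) *: rigidity_row p x y).
  have S1 : \sum_(y in Z) (lam v * lam y) *: rigidity_row p v y =
      (lam v * lam w) *: rigidity_row p v w + \sum_(x in T) (lam v * lam x) *: rigidity_row p v x.
    by rewrite /Z big_setU1 //= rigidity_row_id scaler0 add0r big_setU1.
  have S2 : \sum_(x in w |: T) \sum_(y in Z) (lam x * lam y) *: rigidity_row p x y =
      (lam v * lam w) *: rigidity_row p v w + \sum_(x in T) (lam x * lam v) *: rigidity_row p x v +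
      \sum_(x in w |: T) \sum_(y in w |: T) (lam x * lam y) *: rigidity_row p x y.
    rewrite (eq_bigr (fun x => (lam x * lam v) *: rigidity_row p x v +
      \sum_(y in w |: T) (lam x * lam y) *: rigidity_row p x y)) => [|x _]; last first.
      by rewrite /Z big_setU1.
    rewrite big_split /=; congr (_ + _).
    by rewrite big_setU1 //= (rigidity_row_sym p w v) [lam w * _]mulrC.
  apply/eqP; rewrite -addr_eq0; apply/eqP; apply: etrans stress.
  rewrite /Z [RHS]big_setU1 //= -/Z S1 S2 mulr_natr mulr2n scalerDl.
  rewrite !addrA; congr (_ + _); rewrite -!addrA; congr (_ + _).
  by rewrite addrCA.
rewrite (eqmx_opp _) !addmx_sub //; apply: summx_sub => x xT.
- by apply/scalemx_sub/hv.
- by rewrite rigidity_row_sym; apply/scalemx_sub/hv.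
- by apply: summx_sub => y yT; apply/scalemx_sub/hK.
Qed.

Definition complete W : {set {set V}} := [set e : {set V} | (e \subset W) && (#|e| == 2)].

Lemma mem_complete W x y : ([set x; y] \in complete W) = [&& x \in W, y \in W & x != y].
Proof. by rewrite inE subUset !sub1set cards2 -andbA; case: (x != y). Qed.

(** Over the complete graph on [W :\ v], [d] edges at [v] span all others at [v] by
    [clique_closure], so a vertex adds at most [d]. When [#|W| = d], the number of edges equals the
    bound. *)
Lemma rigidity_rank_complete p W : generic p -> (d <= #|W|)%N ->
  (rigidity_rank p (complete W) + 'C(d.+1, 2) <= d * #|W|)%N.
Proof.
move=> gp; elim: {W}_.+1 {-2}W (ltnSn #|W|) => // n IHn W ltW.
rewrite leq_eqVlt => /orP[/eqP dW|dW].
  rewrite -dW -bin2_sum_square addnC leq_add2l; apply: leq_trans (rigidity_rank_card _ _) _.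
  by rewrite cards_draws dW.
have /card_gt0P[v vW] : (0 < #|W|)%N by apply: leq_trans dW.
have cW := cardsD1 v W; rewrite vW in cW.
have [T TW cT] : exists2 T : {set V}, T \subset W :\ v & #|T| = d by apply: exists_subset_card; lia.
have vT : v \notin T by apply/negP=> /(subsetP TW); rewrite !inE eqxx.
have IH : (rigidity_rank p (complete (W :\ v)) + 'C(d.+1, 2) <= d * #|W :\ v|)%N by apply: IHn; lia.
suff : (rigidity_rank p (complete W) <= rigidity_rank p (complete (W :\ v)) + d)%N.
  by rewrite cW; move: IH; clear; lia.
have key w : w \in W -> w != v ->
    (rigidity_row p v w <= rigidity_mx p (complete (W :\ v) :|: star v T))%MS.
  move=> wW wv; have [wT|wT] := boolP (w \in T).
    by apply: rigidity_row_sub; rewrite inE mem_star ?orbT.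
  apply: (clique_closure gp _ vT wT cT); first by rewrite eq_sym.
    move=> x y xT yT; have [->|xy] := eqVneq x y; first by rewrite rigidity_row_id sub0mx.
    have sub : w |: T \subset W :\ v by rewrite subUset sub1set !inE wv wW.
    by apply: rigidity_row_sub; rewrite inE mem_complete xy !(subsetP sub).
  by move=> x xT; apply: rigidity_row_sub; rewrite inE mem_star ?orbT.
apply: (@leq_trans (rigidity_rank p (complete (W :\ v) :|: star v T))).
  apply/mxrankS/rigidity_mx_subP=> x y; rewrite mem_complete => /and3P[xW yW xy].
  have [xv|xv] := eqVneq x v; first by rewrite xv; apply: key; rewrite // -xv eq_sym.
  have [yv|yv] := eqVneq y v; first by rewrite yv rigidity_row_sym; apply: key.
  by apply: rigidity_row_sub; rewrite inE mem_complete !inE xv yv xW yW xy.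
have := rigidity_rank_submodular p (complete (W :\ v)) (star v T).
have := rigidity_rank_card p (star v T).
have : (#|star v T| <= d)%N by rewrite -cT leq_imset_card.
by clear; lia.
Qed.
End RigidityMatroid.

(** * A lower bound on the rank of closed sets *)

Section RankLowerBound.
Variables (V : finType) (d : nat) (p : V -> 'I_d -> rat) (C : {set {set V}}).
Hypothesis d_gt0 : 0 < d.
Hypothesis gp : generic p.
Hypothesis C2 : {in C, forall e : {set V}, #|e| = 2}.
Hypothesis C_closed : forall x y, x != y ->
  (rigidity_row p x y <= rigidity_mx p C)%MS -> [set x; y] \in C.
Implicit Types (B T : {set V}) (v x : V).

Definition nbrs B v := [set x in B | [set v; x] \in C].

Lemma edge_neq v x : [set v; x] \in C -> v != x.
Proof. by move=> /C2; rewrite cards2; case: (v != x). Qed.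

Lemma avoids_induced B v : avoids v (induced C (B :\ v)).
Proof. by move=> e; rewrite inE subsetD1 => /andP[_ /andP[_]]. Qed.

Lemma star_induced_sub B v T : v \in B -> T \subset nbrs B v ->
  induced C (B :\ v) :|: star v T \subset induced C B.
Proof.
move=> vB TN; rewrite subUset; apply/andP; split; apply/subsetP=> e.
  by rewrite !inE subsetD1 => /and3P[-> ->].
case/imsetP=> x /(subsetP TN); rewrite inE => /andP[xB vx] ->.
by rewrite inE vx subUset !sub1set vB xB.
Qed.

Lemma notin_nbrs B v T : T \subset nbrs B v -> v \notin T.
Proof.
by move=> TN; apply/negP=> /(subsetP TN); rewrite inE => /andP[_ /edge_neq]; rewrite eqxx.
Qed.

Lemma rank_remove_vertex B v : v \in B ->
  rigidity_rank p (induced C (B :\ v)) + minn d #|nbrs B v| <= rigidity_rank p (induced C B).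
Proof.
move=> vB; have [T TN cT] := exists_subset_card (geq_minr d #|nbrs B v|).
rewrite -cT; apply: leq_trans (rank_star_extension gp (@avoids_induced B v) (notin_nbrs TN) _) _.
  by rewrite cT geq_minl.
exact/rigidity_rank_mono/star_induced_sub.
Qed.

(** Since [C] is closed, adding the missing edge [[set u; w]] to [induced C (B :\ v)] raises the
    rank by one; splitting that edge by [v] adds [d] more. *)
Lemma rank_remove_split_vertex B v u w : v \in B -> d < #|nbrs B v| ->
  u \in nbrs B v -> w \in nbrs B v -> u != w -> [set u; w] \notin C ->
  rigidity_rank p (induced C (B :\ v)) + d.+1 <= rigidity_rank p (induced C B).
Proof.
move=> vB dN uN wN uw uwC.
have cN := cardsD1 u (nbrs B v); rewrite uN in cN.
have wNu : w \in nbrs B v :\ u by rewrite in_setD1 eq_sym uw.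
have cNu := cardsD1 w (nbrs B v :\ u); rewrite wNu in cNu.
have [T TN cT] : exists2 T : {set V}, T \subset nbrs B v :\ u :\ w & #|T| = d.-1.
  by apply: exists_subset_card; move: cN cNu dN; clear; lia.
pose T' := u |: (w |: T).
have T'N : T' \subset nbrs B v.
  rewrite !subUset !sub1set uN wN /=; apply: subset_trans TN _.
  by apply: subset_trans (subsetDl _ _) (subsetDl _ _).
have wT : w \notin T by apply/negP=> /(subsetP TN); rewrite !in_setD1 eqxx.
have uT : u \notin w |: T.
  by rewrite in_setU1 negb_or uw; apply/negP=> /(subsetP TN); rewrite !in_setD1 eqxx andbF.
have cT' : #|T'| = d.+1 by rewrite !cardsU1 uT wT cT; move: d_gt0; clear; lia.
apply: leq_trans (rigidity_rank_mono _ (star_induced_sub vB T'N)).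
apply: leq_trans (rank_edge_split gp (@avoids_induced B v) (notin_nbrs T'N) _ _ uw cT').
- rewrite addnS -addSn leq_add2r ltn_neqAle.
  have sub : induced C (B :\ v) \subset [set u; w] |: induced C (B :\ v) by apply: subsetUr.
  have h := mxrank_leqif_sup (rigidity_mxS p sub).
  rewrite /rigidity_rank h.1 h.2 andbT; apply: contra uwC => h'; apply: C_closed => //.
  apply: submx_trans (rigidity_mxS p (_ : induced C (B :\ v) \subset C)); last first.
    by apply/subsetP=> e; rewrite inE => /andP[].
  by apply: submx_trans h'; apply: rigidity_row_sub; rewrite !inE eqxx.
- by rewrite setU11.
- by rewrite !in_setU1 eqxx orbT.
Qed.

Variables (gain : pred V) (u w : V -> V).
Hypothesis gainP : forall v, gain v -> [/\ u v != w v, [set v; u v] \in C,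
  [set v; w v] \in C & [set u v; w v] \notin C].

Definition active B v := [&& gain v, u v \in B & w v \in B].

(** In a uniformly random order, the number [i] of earlier neighbours of a vertex with [D]
    neighbours is uniform on [0..D], and two given neighbours are both among them with probability
    [i * (i - 1) / (D * (D - 1))]. The two sums are the numerators of the resulting averages. *)
Definition small_sum D := \sum_(i < D.+1) minn d i.
Definition pair_sum D := \sum_(i < D.+1) (d < i) * (i * i.-1).

Lemma small_sumS D : small_sum D.+1 = small_sum D + minn d D.+1.
Proof. exact: big_ord_recr. Qed.

Lemma pair_sumS D : pair_sum D.+1 = pair_sum D + (d < D.+1) * (D.+1 * D).
Proof. exact: big_ord_recr. Qed.

Lemma small_sum_small D : D <= d -> small_sum D = 'C(D.+1, 2).
Proof.
elim: D => [|D IHD] Dd; first by rewrite /small_sum big_ord1 minn0.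
by rewrite small_sumS IHD 1?ltnW // (minn_idPr Dd) [RHS]binS bin1 addnC.
Qed.

Lemma small_sum_closed D : d <= D.+1 -> small_sum D + 'C(d.+1, 2) = d * D.+1.
Proof.
elim: D => [|D IHD].
  move=> d1; have {}d1 : d = 1 by move: d1 d_gt0; clear; lia.
  by rewrite small_sum_small // d1.
rewrite leq_eqVlt => /orP[/eqP dD|dD]; last first.
  by rewrite small_sumS (minn_idPl _) // addnAC IHD // [RHS]mulnS addnC.
by rewrite small_sum_small; [rewrite -dD addnC bin2_sum_square|rewrite dD].
Qed.

(** The terms [3 * i * (i - 1)] telescope as differences of [(i + 1) * i * (i - 1)]. *)
Lemma pair_sum_closed D : d <= D -> 3 * pair_sum D + d.+1 * (d * d.-1) = D.+1 * (D * D.-1).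
Proof.
elim: D => [|D IHD]; first by rewrite leqNgt d_gt0.
rewrite leq_eqVlt => /orP[/eqP <-|dD].
  rewrite (_ : pair_sum d = 0) ?add0n // /pair_sum big1 // => i _.
  by rewrite ltnNge -ltnS ltn_ord.
rewrite pair_sumS dD mulnDr addnAC IHD //=.
by case: D {IHD dD} => [|D] //=; lia.
Qed.

Local Open Scope ring_scope.

(* The expected rank increment of [v] when the vertices of [B] arrive in a uniformly random
   order: [minn d i] for [i] earlier neighbours, plus one if [i > d] and the nonadjacent
   neighbours [u v], [w v] are both earlier. *)
Definition expected_gain B v : rat := let D := #|nbrs B v| in
  (small_sum D)%:R / D.+1%:R +
  if active B v then (pair_sum D)%:R / (D.+1 * (D * D.-1))%:R else 0.

Lemma active_nbrs B v : active B v -> [/\ u v \in nbrs B v, w v \in nbrs B v & u v != w v].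
Proof. by case/and3P=> /gainP[uw vu vw _] uB wB; rewrite !inE uB wB vu vw. Qed.

Definition increment B v : nat := (minn d #|nbrs B v| + (active B v && (d < #|nbrs B v|)%N))%N.

Lemma rank_increment B v : v \in B ->
  (rigidity_rank p (induced C (B :\ v)) + increment B v <= rigidity_rank p (induced C B))%N.
Proof.
rewrite /increment => vB; case: andP => [[aB dN]|_]; last first.
  by rewrite addn0; apply: rank_remove_vertex.
have [uN wN uw] := active_nbrs aB; have /and3P[/gainP[_ _ _ uwC] _ _] := aB.
apply: leq_trans (rank_remove_split_vertex vB dN uN wN uw uwC).
by rewrite leq_add2l addn1 ltnS geq_minl.
Qed.

Lemma nbrs_D1 B v x : nbrs (B :\ v) x = nbrs B x :\ v.
Proof. by apply/setP=> y; rewrite !inE andbA. Qed.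

(* Conditioning on the last vertex of the random order. *)
Lemma expected_gain_rec B x : x \in B ->
  #|B|%:R * expected_gain B x = (increment B x)%:R + \sum_(v in B :\ x) expected_gain (B :\ v) x.
Proof.
move=> xB; set N := nbrs B x; set D := #|N|.
have NB : N \subset B :\ x.
  by apply/subsetP=> y; rewrite !inE => /andP[-> /edge_neq]; rewrite eq_sym => ->.
have cB : #|B| = (#|B :\ x :\: N| + D).+1.
  by rewrite (cardsD1 x) xB add1n addnC -(cardsID N (B :\ x)) (setIidPr NB).
rewrite (big_setID N) /= (setIidPr NB).
(* Deleting a non-neighbour changes nothing, so these terms cancel and only deletions of neighbours
   remain. *)
have out v : v \in B :\ x :\: N -> expected_gain (B :\ v) x = expected_gain B x.
  move=> vN; have vN' : v \notin N by case/setDP: vN.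
  have eN : nbrs (B :\ v) x = N.
    by rewrite nbrs_D1; apply/setDidPl; rewrite disjoint_sym disjoints1.
  rewrite /expected_gain eN -/N; congr (_ + _); congr (if _ then _ else _).
  apply/idP/idP=> [/and3P[g]|aB].
    by rewrite !inE => /andP[_ uB] /andP[_ wB]; apply/and3P.
  have [uN wN _] := active_nbrs aB; case/and3P: aB => g uB wB.
  apply/and3P; split=> //; rewrite !inE ?uB ?wB andbT.
    by apply: contraNneq vN' => <-.
  by apply: contraNneq vN' => <-.
rewrite (eq_bigr (fun=> expected_gain B x) (P := mem (B :\ x :\: N))) //.
rewrite sumr_const cB -addn1 [(_ + 1)%:R]natrD [(_ + D)%:R]natrD !mulrDl mul1r.
rewrite -[expected_gain B x *+ _]mulr_natl.
suff main : (D.+1)%:R * expected_gain B x =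
    (increment B x)%:R + \sum_(v in N) expected_gain (B :\ v) x.
  by rewrite [RHS]addrA -main -natr1; ring.
have [D0|D0] := posnP D.
  have N0 : N = set0 by apply/eqP; rewrite -cards_eq0 -/D D0.
  have aB : active B x = false by apply/negP=> /active_nbrs[]; rewrite -/N N0 inE.
  rewrite N0 big_set0 /expected_gain /increment aB -/N -/D D0 /small_sum big_ord1 !minn0.
  by rewrite mul0r !addr0 mulr0.
(* Deleting a neighbour leaves [D - 1] of them; an active [x] stays active for the [D - 2] deletions
   other than [u x] and [w x]. *)
have inn v : v \in N -> expected_gain (B :\ v) x = (small_sum D.-1)%:R / D%:R +
    (if active B x && (v != u x) && (v != w x)
     then (pair_sum D.-1)%:R / (D * (D.-1 * D.-2))%:R else 0).
  move=> vN; have cN : #|nbrs (B :\ v) x| = D.-1 by rewrite nbrs_D1 -/N /D (cardsD1 v N) vN.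
  rewrite /expected_gain cN prednK //; congr (_ + _); congr (if _ then _ else _).
  by rewrite /active !inE ![v == _]eq_sym; case: (gain x); case: (u x == v); case: (w x == v);
     case: (u x \in B); case: (w x \in B).
rewrite (eq_bigr _ inn) big_split /= sumr_const -/D.
have sE : (small_sum D = small_sum D.-1 + minn d D)%N.
  by rewrite -{1}(prednK D0) small_sumS prednK.
have pE : (pair_sum D = pair_sum D.-1 + (d < D) * (D * D.-1))%N.
  by rewrite -{1}(prednK D0) pair_sumS prednK.
have DN : D%:R != 0 :> rat by rewrite pnatr_eq0 -lt0n.
have D1N : D.+1%:R != 0 :> rat by rewrite pnatr_eq0.
rewrite -big_mkcondr /= sumr_const.
rewrite /expected_gain /increment -/N -/D.
have [aB|aB] := boolP (active B x); last first.
  rewrite addr0 /= addn0 eq_card0 ?mulr0n ?addr0; last by move=> v; rewrite -topredE /= andbF.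
  by rewrite mulrCA mulfV // mulr1 -[_ *+ D]mulr_natr divfK // sE natrD addrC.
have [uN wN uw] := active_nbrs aB.
have cD : #|[pred v | (v \in N) && ((true && (v != u x)) && (v != w x))]| = D.-2.
  rewrite (_ : #|_| = #|N :\ u x :\ w x|); last first.
    by apply: eq_card => v; rewrite !inE;
       case: (v \in B); case: (_ \in C); case: (v == u x); case: (v == w x).
  by rewrite /D (cardsD1 (u x) N) uN (cardsD1 (w x) (N :\ u x)) in_setD1 eq_sym uw wN.
rewrite (_ : #|_| = D.-2) -?cD; last by apply: eq_card => v; rewrite !inE.
have D2 : (1 < D)%N by apply/card_gt1P; exists (u x), (w x).
have [m Dm] : exists m, D = m.+2 by exists D.-2; move: D2; case: (D) => [|[]].
have Dm1 : D.-1 = m.+1 by rewrite Dm.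
have Dm2 : D.-2 = m by rewrite Dm.
rewrite cD -[_ *+ D]mulr_natr -[_ *+ D.-2]mulr_natr sE pE /= Dm2 Dm1 Dm.
rewrite !natrM !natrD !natrM -!natr1.
have m1 : m%:R + 1 != 0 :> rat by rewrite natr1 pnatr_eq0.
have m2 : m%:R + 1 + 1 != 0 :> rat by rewrite !natr1 pnatr_eq0.
have m3 : m%:R + 1 + 1 + 1 != 0 :> rat by rewrite !natr1 pnatr_eq0.
(* For [D = 2] the denominator of the recursive pair term is zero, and the term contributes
   nothing. *)
have [m0|m0] := posnP m.
  rewrite m0 mulr0 (_ : pair_sum 1 = 0%N) /=; last first.
    by rewrite /pair_sum big_ord_recr big_ord1 /= !muln0.
  by field.
have m0' : m%:R != 0 :> rat by rewrite pnatr_eq0 -lt0n.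
by field; rewrite ?m0' ?m1 ?m2 ?m3.
Qed.

(** Averaging over the last vertex [v]: the other gains are bounded by induction on [B :\ v], and
    [rank_increment] accounts for [v]. *)
Lemma expected_gain_le_rank B :
  \sum_(v in B) expected_gain B v <= (rigidity_rank p (induced C B))%:R.
Proof.
elim: {B}_.+1 {-2}B (ltnSn #|B|) => // n IHn B ltB.
have [->|[x0 x0B]] := set_0Vmem B; first by rewrite big_set0 ler0n.
have cB : 0 < #|B|%:R :> rat by rewrite ltr0n (cardsD1 x0) x0B.
rewrite -(ler_pM2l cB) mulr_sumr (eq_bigr _ (fun x => @expected_gain_rec B x)) big_split /=.
apply: (@le_trans _ _ (\sum_(v in B) ((increment B v)%:R +
  (rigidity_rank p (induced C (B :\ v)))%:R))).
  rewrite [leRHS]big_split lerD2l /=.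
  rewrite (exchange_big_dep (mem B)) /=; last by move=> x v _ /setD1P[].
  apply: ler_sum => v vB; rewrite (eq_bigl (mem (B :\ v))); last first.
    by move=> x; rewrite !inE vB andbT eq_sym andbC.
  by apply: IHn; move: ltB; rewrite (cardsD1 v) vB; lia.
rewrite [leRHS]mulr_natl -[leRHS]sumr_const; apply: ler_sum => v vB.
by rewrite -natrD ler_nat addnC rank_increment.
Qed.

End RankLowerBound.

(** * The packing condition for highly connected graphs *)

Lemma double_bin2 n : 2 * 'C(n.+1, 2) = n.+1 * n.
Proof. by elim: n => // n IHn; rewrite binS bin1 mulnDr IHn; lia. Qed.

Lemma connect_stable (T : finType) (e : rel T) (A : {set T}) x y :
  (forall z z', z \in A -> e z z' -> z' \in A) -> connect e x y -> x \in A -> y \in A.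
Proof.
move=> hA /connectP[s hs ->]; elim: s x hs => //= z s IHs x /andP[xz hs] xA.
by apply: IHs => //; apply: hA xz.
Qed.

Definition edges (G : sgraph) : {set {set G}} :=
  [set e : {set G} | [exists x, exists y, (e == [set x; y]) && adj x y]].

Lemma mem_edges (G : sgraph) (x y : G) : ([set x; y] \in edges G) = adj x y.
Proof.
rewrite inE; apply/existsP/idP => [[x' /existsP[y' /andP[/eqP/set2_eq h a]]]|a].
  by case: h => -[-> ->] //; rewrite adj_sym.
by exists x; apply/existsP; exists y; rewrite eqxx.
Qed.

Lemma edgesP (G : sgraph) (e : {set G}) : e \in edges G -> exists x y, e = [set x; y] /\ adj x y.
Proof. by rewrite inE => /existsP[x /existsP[y /andP[/eqP-> a]]]; exists x, y. Qed.

Lemma adj_neq (G : sgraph) (x y : G) : adj x y -> x != y.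
Proof. by apply: contraTneq => ->; rewrite adj_irr. Qed.

Lemma card_edge (G : sgraph) : {in edges G, forall e : {set G}, #|e| = 2}.
Proof. by move=> e /edgesP[x [y [-> /adj_neq]]]; rewrite cards2 => ->. Qed.

(** Otherwise deleting the neighbours of [x] would cut it off from some remaining vertex. *)
Lemma k_connected_degree k (G : sgraph) (x : G) :
  k_connected k G -> k <= #|[set y | adj x y]|.
Proof.
move=> [cG hG]; rewrite leqNgt; apply/negP=> lt.
have xN : x \notin [set y | adj x y] by rewrite inE adj_irr.
have [y] : exists y, y \in ~: (x |: [set y | adj x y]).
  by apply/card_gt0P; rewrite cardsCs setCK cardsU1 xN; move: cG lt; clear; lia.
rewrite !inE negb_or => /andP[yx yN].
have := hG _ lt x y xN; rewrite inE => /(_ yN) h.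
move: yx; rewrite -in_set1 (connect_stable _ h) ?set11 // => z z' /set1P->.
by rewrite /delete /= !inE => /andP[/andP[_ /negP xz'] /xz'].
Qed.

Section Closure.
Variables (V : finType) (d : nat) (p : V -> 'I_d -> rat) (F : {set {set V}}).

Definition rigidity_closure : {set {set V}} :=
  [set e : {set V} | [exists x, exists y,
    [&& e == [set x; y], x != y & (rigidity_row p x y <= rigidity_mx p F)%MS]]].

Lemma mem_rigidity_closure x y : ([set x; y] \in rigidity_closure) =
  (x != y) && (rigidity_row p x y <= rigidity_mx p F)%MS.
Proof.
rewrite inE; apply/existsP/idP => [[x' /existsP[y' /and3P[/eqP/set2_eq h a b]]]|a].
  by case: h => -[-> ->]; rewrite ?a ?b // eq_sym rigidity_row_sym a b.
by exists x; apply/existsP; exists y; rewrite eqxx.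
Qed.

Lemma card_rigidity_closure : {in rigidity_closure, forall e : {set V}, #|e| = 2}.
Proof.
by move=> e; rewrite inE => /existsP[x /existsP[y /and3P[/eqP-> + _]]]; rewrite cards2 => ->.
Qed.

Lemma rigidity_closure_mx : (rigidity_mx p rigidity_closure <= rigidity_mx p F)%MS.
Proof. by apply/rigidity_mx_subP=> x y; rewrite mem_rigidity_closure => /andP[]. Qed.

Lemma rigidity_closure_closed x y : x != y ->
  (rigidity_row p x y <= rigidity_mx p rigidity_closure)%MS -> [set x; y] \in rigidity_closure.
Proof.
by move=> xy h; rewrite mem_rigidity_closure xy (submx_trans h) // rigidity_closure_mx.
Qed.
End Closure.

Section PackingCondition.
Variables (G : sgraph) (d k : nat) (p : G -> 'I_d -> rat) (C : {set {set G}}).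
Hypothesis d_gt0 : 0 < d.
Hypothesis gp : generic p.
Hypothesis C2 : {in C, forall e : {set G}, #|e| = 2}.
Hypothesis C_closed : forall x y, x != y ->
  (rigidity_row p x y <= rigidity_mx p C)%MS -> [set x; y] \in C.
Hypothesis hk : 4 * 'C(d.+1, 2) <= k.
Hypothesis hG : k_connected k G.
Implicit Types (x y v w : G).

(* The [C]-neighbourhood [K v] of an inner vertex is a clique which, by connectivity, has at
   least [k] vertices in [B]; so the inner vertices contribute exactly [d] each to the rank.
   A vertex of [B] has a missing edge, or two nonadjacent neighbours in [B] whose expected
   gain compensates for its expected rank deficit. *)
Let E := edges G.
Let missing v := #|[set e in E :\: C | v \in e]|.
Let N v := nbrs C setT v.
Let inner v := (missing v == 0) &&
  [forall x in N v, forall y in N v, (x != y) ==> ([set x; y] \in C)].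
Let B := [set v | ~~ inner v].
Let K v := v |: N v.

Lemma sum_missing : \sum_v missing v = 2 * #|E :\: C|.
Proof.
rewrite /missing; under eq_bigr do rewrite -sum1_card.
rewrite (exchange_big_dep (mem (E :\: C))) /=; last by move=> v e _; rewrite inE => /andP[].
rewrite mulnC -sum_nat_const; apply: eq_bigr => e eEC.
rewrite sum1_card -(@card_edge G e); last by case/setDP: eEC.
apply: eq_card => v.
by rewrite unfold_in -[X in X = _]/(e \in [set e0 in E :\: C | v \in e0]) inE eEC.
Qed.

Lemma in_N v x : (x \in N v) = ([set v; x] \in C).
Proof. by rewrite !inE. Qed.

Lemma in_N_sym v x : (x \in N v) = (v \in N x).
Proof. by rewrite !in_N setUC. Qed.

Lemma N_neq v x : x \in N v -> v != x.
Proof. by rewrite in_N; apply: edge_neq. Qed.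

Lemma degree_le v : k <= missing v + #|N v|.
Proof.
apply: leq_trans (k_connected_degree v hG) _.
rewrite -(cardsID (N v)) addnC; apply: leq_add; last by apply/subset_leq_card/subsetIr.
rewrite -(card_in_imset (f := fun y => [set v; y])); last first.
  move=> y y' _ _ /set2_eq []; first by case.
  by case=> -> ->.
apply/subset_leq_card/subsetP=> e /imsetP[y]; rewrite in_setD in_N inE => /andP[yC a] ->.
by rewrite in_set in_setD yC mem_edges a in_set2 eqxx.
Qed.

Lemma adj_missing0 v x : missing v = 0 -> adj v x -> x \in N v.
Proof.
move=> /eqP; rewrite cards_eq0 => /eqP/setP/(_ [set v; x]).
rewrite in_N in_set in_setD in_set0 in_set2 eqxx andbT mem_edges => + a.
by rewrite a andbT => /negbFE.
Qed.

Lemma inner_clique v x y : inner v -> x \in K v -> y \in K v -> x != y -> [set x; y] \in C.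
Proof.
case/andP=> _ /forall_inP h; rewrite !in_setU1 => /orP[/eqP->|xN] /orP[/eqP->|yN] xy.
- by rewrite eqxx in xy.
- by rewrite -in_N.
- by rewrite setUC -in_N.
- by have /forall_inP/(_ y yN)/implyP := h x xN; apply.
Qed.

Hypothesis C_incomplete : exists x y, x != y /\ [set x; y] \notin C.

(** Otherwise [K v :&: B] could be deleted. A path from [v] avoiding it never leaves [K v]: each
    vertex [z] on it is inner, so [v] and the next vertex both lie in the clique [K z].
    Incompleteness provides a vertex outside [K v]. *)
Lemma inner_boundary v : inner v -> k <= #|K v :&: B|.
Proof.
move=> iv; rewrite leqNgt; apply/negP=> lt.
have [y yK] : exists y, y \notin K v.
  case: C_incomplete => x [y [xy xyC]].
  have [xK|] := boolP (x \in K v); last by exists x.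
  have [yK|] := boolP (y \in K v); last by exists y.
  by rewrite (inner_clique iv xK yK) in xyC.
have vS : v \notin K v :&: B by rewrite !inE iv andbF.
have yS : y \notin K v :&: B by rewrite in_setI (negPf yK).
have h := hG.2 _ lt v y vS yS.
move: yK; rewrite (connect_stable _ h) //; last by rewrite setU11.
move=> z z' zK; rewrite /delete /= !in_setC => /andP[/andP[zS _] zz'].
have iz : inner z by move: zS; rewrite in_setI zK inE /= negbK.
have z'N : z' \in N z by apply: adj_missing0 => //; case/andP: iz => /eqP.
have [->|vz'] := eqVneq z' v; first by rewrite setU11.
apply/setU1P; right; rewrite in_N; apply: (inner_clique iz); rewrite 1?eq_sym //.
  by move: zK; rewrite !in_setU1 => /orP[/eqP->|]; rewrite ?eqxx // in_N_sym orbC => ->.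
by rewrite in_setU1 z'N orbT.
Qed.

Lemma d_le_k : d < k.
Proof.
apply: leq_trans hk; have := double_bin2 d; move: d_gt0; case: (d) => // m _.
by move: ('C(_, _)) => c; lia.
Qed.

(** With [d] neighbours of [w] in the clique [K x], [clique_closure] would put the edge [w x] into
    [C]. *)
Lemma outside_few_nbrs x w : inner x -> w \notin K x -> #|N w :&: K x| < d.
Proof.
move=> ix wK; rewrite ltnNge; apply/negP=> /exists_subset_card[T TN cT].
have xw : x != w by apply: contraNneq wK => ->; rewrite setU11.
have wx : w \notin N x by move: wK; rewrite in_setU1 negb_or => /andP[].
have xT : x \notin T.
  by apply/negP=> /(subsetP TN); rewrite in_setI in_N_sym (negPf wx).
have wT : w \notin T.
  by apply/negP=> /(subsetP TN); rewrite in_setI => /andP[/N_neq]; rewrite eqxx.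
have TK : x |: T \subset K x.
  by rewrite subUset sub1set setU11; apply: subset_trans TN (subsetIr _ _).
move: wx; rewrite in_N_sym in_N => /negP; apply; apply: C_closed; first by rewrite eq_sym.
apply: (clique_closure gp _ wT xT cT); first by rewrite eq_sym.
  move=> y z yT zT; have [->|yz] := eqVneq y z; first by rewrite rigidity_row_id sub0mx.
  by apply: rigidity_row_sub; apply: (inner_clique ix) => //; apply: (subsetP TK).
move=> y /(subsetP TN); rewrite in_setI in_N => /andP[wy _].
exact: rigidity_row_sub.
Qed.

(** An inner [u] is replaced within its clique: [K u :&: B] has at least [k > d] vertices, fewer
    than [d] of them adjacent to [w], and [v] itself belongs to [K u]. *)
Lemma move_to_boundary v u w : u \in N v -> w \in N v -> u != w -> [set u; w] \notin C ->
  exists u', [/\ u' \in B, u' \in N v, u' != w & [set u'; w] \notin C].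
Proof.
move=> uv wv uw uwC; have [iu|iu] := boolP (inner u); last by exists u; rewrite inE.
have wK : w \notin K u by rewrite in_setU1 eq_sym negb_or uw in_N.
have [u' u'K u'N] : exists2 u', u' \in K u :&: B & u' \notin N w.
  apply/subsetPn/negP=> sub.
  have : #|K u :&: B| <= #|N w :&: K u|.
    by apply: subset_leq_card; rewrite subsetI sub subsetIl.
  have := outside_few_nbrs iu wK; have := inner_boundary iu; have := d_le_k.
  by clear; lia.
have /setIP[u'Ku u'B] := u'K.
exists u'; split=> //.
- have u'v : v != u' by apply: contraNneq u'N => <-; rewrite in_N_sym.
  by rewrite in_N; apply: (inner_clique iu) => //; rewrite in_setU1 in_N_sym uv orbT.
- by apply: contraNneq wK => <-.
- by rewrite setUC -in_N.
Qed.

Lemma boundary_gain v : v \in B -> missing v = 0 -> exists u w,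
  [/\ u \in B, w \in B, u \in N v /\ w \in N v, u != w & [set u; w] \notin C].
Proof.
rewrite inE /inner => + m0; rewrite m0 eqxx /= => /forall_inPn[u uN /forall_inPn[w wN]].
rewrite negb_imply => /andP[uw uwC].
have [u' [u'B u'N u'w u'wC]] := move_to_boundary uN wN uw uwC.
have [||w' [w'B w'N w'u w'uC]] := @move_to_boundary v w u' wN u'N.
- by rewrite eq_sym.
- by rewrite setUC.
exists u', w'; split=> //; first by rewrite eq_sym.
by rewrite setUC.
Qed.

(** If [v] is a neighbour of an inner [x], the clique [K x] supplies [k] vertices of [B], possibly
    including [v] itself, whence the [1]. Otherwise all of [N v] lies in [B]. *)
Lemma boundary_degree v : v \in B -> k <= maxn 1 (missing v) + #|nbrs C B v|.
Proof.
move=> vB; have [/existsP[x /andP[ix vx]]|hx] := boolP [exists x, inner x && (x \in N v)].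
  apply: leq_trans (inner_boundary ix) _; rewrite (cardsD1 v).
  apply: leq_add; first by case: (_ \in _); rewrite leq_max.
  apply/subset_leq_card/subsetP=> y /setD1P[yv /setIP[yK yB]].
  rewrite inE yB; apply: (inner_clique ix) => //; last by rewrite eq_sym.
  by rewrite in_setU1 in_N_sym vx orbT.
apply: leq_trans (degree_le v) _; apply: leq_add; first exact: leq_maxr.
apply/subset_leq_card/subsetP=> y yN; rewrite inE -in_N yN andbT inE.
by apply: contra hx => iy; apply/existsP; exists y; rewrite iy.
Qed.

Lemma rank_add_inner (B' : {set G}) : B \subset B' ->
  rigidity_rank p (induced C B) + d * #|B' :\: B| <= rigidity_rank p (induced C B').
Proof.
elim: {B'}_.+1 {-2}B' (ltnSn #|B' :\: B|) => // n IHn B' ltB' BB'.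
have [e0|[x xB']] := set_0Vmem (B' :\: B).
  rewrite e0 cards0 muln0 addn0 (_ : B' = B) //; apply/eqP; rewrite eqEsubset BB' andbT.
  by rewrite -setD_eq0 e0.
have /setDP[xB'1 xB] := xB'.
have cB : #|B' :\: B| = #|(B' :\ x) :\: B|.+1.
  by rewrite (cardsD1 x) xB' add1n !setDDl setUC.
have sub : B \subset B' :\ x by rewrite subsetD1 BB'.
have := IHn (B' :\ x); rewrite -ltnS -cB => /(_ ltB' sub).
have := rank_remove_vertex gp C2 xB'1.
have ix : inner x by move: xB; rewrite inE negbK.
have -> : minn d #|nbrs C B' x| = d.
  apply/minn_idPl; apply: leq_trans (ltnW d_le_k) (leq_trans (inner_boundary ix) _).
  apply/subset_leq_card/subsetP=> y /setIP[yK yB]; rewrite inE (subsetP BB') //=.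
  move: yK; rewrite in_setU1 => /orP[/eqP yx|]; last by rewrite in_N.
  by rewrite yx (negPf xB) in yB.
by rewrite cB mulnS; clear; lia.
Qed.

Local Open Scope ring_scope.

(** Each edge outside [C] counts one half against the rank and is shared by its two ends, so a
    missing edge pays a quarter at [v]. *)
Lemma expected_gain_boundary (gain : pred G) (u w : G -> G) v :
  v \in B -> (missing v = 0%N -> active gain u w B v) ->
  (4 * d)%:R <= (missing v)%:R + 4%:R * expected_gain d C gain u w B v.
Proof.
move=> vB act; rewrite /expected_gain; set D := #|nbrs C B v|.
have kD := boundary_degree vB; rewrite -/D in kD.
have cd := double_bin2 d; have hk' := hk; set c := 'C(d.+1, 2) in cd hk'.
have D1 : D.+1%:R != 0 :> rat by rewrite pnatr_eq0.
have [m0|m0] := posnP (missing v).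
  rewrite act // m0 add0r; rewrite m0 in kD.
  have dD : (d < D)%N by have := d_le_k; lia.
  have D2 : (1 < D)%N by lia.
  have sE := small_sum_closed d_gt0 (leqW (ltnW dD)); rewrite -/c in sE.
  have pE := pair_sum_closed d_gt0 (ltnW dD).
  (* The first average falls short of [d] by [c / (D + 1)]. The pair bonus covers this because
     [D + 1 >= 4 * c], while [2 * c * (d - 1) <= c * (D * (D - 1))]. *)
  have main : (c * (D * D.-1) <= pair_sum d D)%N.
    have P1 : (D.+1 * (D * D.-1) = D.+1 * D.-1 * D)%N by rewrite mulnAC -mulnA.
    have dm : (d.+1 * (d * d.-1) = 2 * c * d.-1)%N by rewrite cd mulnA.
    have h1 : (4 * c * (D * D.-1) <= D.+1 * (D * D.-1))%N by rewrite leq_mul2r; lia.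
    have h2 : (2 * c * d.-1 <= c * (D * D.-1))%N.
      by rewrite mulnAC mulnC leq_mul2l; apply/orP; right; apply: leq_mul; lia.
    by move: pE h1 h2 dm; rewrite -!mulnA; clear; lia.
  have P0 : 0 < (D * D.-1)%:R :> rat by rewrite ltr0n muln_gt0; lia.
  have P1 : 0 < D.+1%:R :> rat by rewrite ltr0n.
  suff : d%:R * D.+1%:R * (D * D.-1)%:R <=
      (small_sum d D)%:R * (D * D.-1)%:R + (pair_sum d D)%:R :> rat.
    have alg (a b s t : rat) : 0 < a -> 0 < b -> s / b + t / (b * a) = (s * a + t) / (b * a).
      by move=> /lt0r_neq0 a0 /lt0r_neq0 b0; field; rewrite a0 b0.
    move=> h; rewrite natrM ler_pM2l // [(D.+1 * _)%:R]natrM alg //.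
    by rewrite ler_pdivlMr ?mulr_gt0 // mulrA.
  by rewrite -!natrM -natrD ler_nat -sE mulnDl leq_add2l.
have g0 : 0 <= if active gain u w B v then (pair_sum d D)%:R / (D.+1 * (D * D.-1))%:R else 0 :> rat.
  by case: ifP => // _; rewrite divr_ge0 ?ler0n.
set g := (if _ then _ else _) in g0 *.
have [big|small] := leqP (4 * d) (missing v).
  apply: le_trans (_ : (missing v)%:R <= _); first by rewrite ler_nat.
  by rewrite lerDl mulr_ge0 ?addr_ge0 ?divr_ge0 ?ler0n.
have kD' : (k <= missing v + D)%N by move: kD; rewrite (maxn_idPr m0).
have dc : (4 * d <= 4 * c)%N.
  by have : (2 * d <= 2 * c)%N; [rewrite cd leq_mul2r; lia | lia].
have dD : (d <= D.+1)%N.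
  case: (ltngtP d 1) => [|d1|d1]; [lia| |by rewrite d1].
  have : (3 * d <= d.+1 * d)%N by rewrite leq_mul2r; lia.
  lia.
have sE := small_sum_closed d_gt0 dD; rewrite -/c in sE.
(* Here the missing edges pay for the shortfall: [missing v * (D + 1) >= missing v + D >= k]. *)
have main : (4 * c <= missing v * D.+1)%N.
  apply: leq_trans hk' _; apply: leq_trans kD' _.
  by rewrite mulnS leq_add2l leq_pmull.
have P1 : 0 < D.+1%:R :> rat by rewrite ltr0n.
suff h : (4 * d)%:R * D.+1%:R <= (missing v)%:R * D.+1%:R + 4%:R * (small_sum d D)%:R :> rat.
  have : (4 * d)%:R <= ((missing v)%:R * D.+1%:R + 4%:R * (small_sum d D)%:R) / D.+1%:R :> rat.
    by rewrite ler_pdivlMr.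
  move/le_trans; apply; rewrite mulrDl mulfK // -mulrA mulrDr addrA lerDl.
  by rewrite mulr_ge0 ?ler0n.
rewrite -!natrM -natrD ler_nat.
by move: main sE; rewrite -mulnA => + <-; rewrite mulnDr addnC leq_add2r.
Qed.

Lemma packing_condition_incomplete :
  (2 * (d * #|G| - 'C(d.+1, 2)) <= #|E :\: C| + 2 * rigidity_rank p C)%N.
Proof.
pose good v (z : G * G) := [&& z.1 \in B, z.2 \in B, z.1 \in N v, z.2 \in N v,
  z.1 != z.2 & [set z.1; z.2] \notin C].
(* The default pair [(v, v)] is never good, so [gain v] holds exactly when a good pair exists. *)
pose z v := odflt (v, v) [pick z | good v z].
pose gain v := good v (z v).
pose u v := (z v).1; pose w v := (z v).2.
have gainP v : gain v -> [/\ u v != w v, [set v; u v] \in C,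
    [set v; w v] \in C & [set u v; w v] \notin C].
  by case/and5P=> _ _ + + /andP[? ?]; rewrite !in_N.
have act v : v \in B -> missing v = 0%N -> active gain u w B v.
  move=> vB m0; suff gv : gain v by rewrite /active gv; case/and5P: gv => -> ->.
  have [x [y [xB yB [xN yN] xy xyC]]] := boundary_gain vB m0.
  rewrite /gain /z; case: pickP => [//|/(_ (x, y))].
  by rewrite /good /= xB yB xN yN xy xyC.
have h1 := expected_gain_le_rank d_gt0 gp C2 C_closed gainP B.
have h2 : \sum_(v in B) (4 * d)%:R <=
    \sum_(v in B) ((missing v)%:R + 4%:R * expected_gain d C gain u w B v) :> rat.
  by apply: ler_sum => v vB; apply: expected_gain_boundary => // ?; apply: act.
rewrite sumr_const big_split /= -mulr_sumr in h2.
have h3 : (\sum_(v in B) missing v <= 2 * #|E :\: C|)%N.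
  by rewrite -sum_missing [leqRHS](bigID (mem B)) /= leq_addr.
have h4 := rank_add_inner (subsetT B).
have h5 : induced C setT = C by apply/setP=> e; rewrite inE subsetT andbT.
have h6 : (#|B| + #|setT :\: B| = #|G|)%N by rewrite setTD cardsC.
rewrite h5 in h4.
have h7 : (4 * d * #|B| <= 2 * #|E :\: C| + 4 * rigidity_rank p (induced C B))%N.
  rewrite -(ler_nat rat) natrM mulr_natr; apply: le_trans h2 _.
  rewrite natrD lerD //; first by rewrite -natr_sum ler_nat.
  by rewrite [leRHS]natrM ler_wpM2l // ler0n.
by move: h4 h7; rewrite -h6 mulnDr -!mulnA; clear; lia.
Qed.
End PackingCondition.

(** In [expected_gain_le_rank] without gaining vertices, the averages add up to
    [small_sum d #|V|.-1]. This covers the case excluded by [C_incomplete]. *)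
Lemma rank_complete_ge (V : finType) d (p : V -> 'I_d -> rat) (C : {set {set V}}) :
  0 < d -> generic p -> d <= #|V| -> {in C, forall e : {set V}, #|e| = 2} ->
  (forall x y, x != y -> [set x; y] \in C) ->
  (d * #|V| <= rigidity_rank p C + 'C(d.+1, 2)).
Proof.
move=> d0 gp dV C2 hC.
have n0 : (0 < #|V|) by apply: leq_trans d0 dV.
have := @expected_gain_le_rank V d p C d0 gp C2 (fun x y xy _ => hC x y xy) pred0 id id
  (fun v (h : false) => False_ind _ (notF h)) setT.
have -> : induced C setT = C by apply/setP=> e; rewrite inE subsetT andbT.
have cN v : #|nbrs C setT v| = #|V|.-1.
  rewrite -(cardsC1 v); apply: eq_card => x; rewrite !inE /=.
  have [->|xv] := eqVneq x v; last by rewrite hC // eq_sym.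
  by apply/negP=> /C2; rewrite cards2 eqxx.
rewrite (eq_bigr (fun=> (small_sum d #|V|.-1)%:R / #|V|%:R)%R) => [|v _]; last first.
  by rewrite /expected_gain /active /= cN addr0 prednK.
rewrite sumr_const cardsT -[(_ *+ _)%R]mulr_natr divfK ?pnatr_eq0 -?lt0n // ler_nat.
have := @small_sum_closed d d0 #|V|.-1; rewrite prednK // => /(_ dV) <-.
by rewrite leq_add2r.
Qed.

(** Passing to the closure keeps the rank and can only shrink [edges G :\: C]. *)
Theorem packing_condition (G : sgraph) (d k : nat) (p : G -> 'I_d -> rat) (C : {set {set G}}) :
  (0 < d) -> generic p -> (4 * 'C(d.+1, 2) <= k) -> k_connected k G -> C \subset edges G ->
  (2 * (d * #|G| - 'C(d.+1, 2)) <= #|edges G :\: C| + 2 * rigidity_rank p C).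
Proof.
move=> d0 gp hk hG CE; set C' := rigidity_closure p C.
have CC' : C \subset C'.
  apply/subsetP=> e eC; have [x [y [ee a]]] := edgesP (subsetP CE e eC).
  by rewrite ee mem_rigidity_closure adj_neq // rigidity_row_sub // -ee.
have rC : (rigidity_rank p C' <= rigidity_rank p C) by apply/mxrankS/rigidity_closure_mx.
have cC : (#|edges G :\: C'| <= #|edges G :\: C|) by apply/subset_leq_card/setDS.
suff : (2 * (d * #|G| - 'C(d.+1, 2)) <= #|edges G :\: C'| + 2 * rigidity_rank p C').
  by move: rC cC; clear; lia.
have [/existsP[x /existsP[y /andP[xy xyC]]]|h] :=
    boolP [exists x, exists y, (x != y) && ([set x; y] \notin C')].
  apply: (packing_condition_incomplete d0 gp _ _ hk hG).
  - exact: card_rigidity_closure.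
  - exact: rigidity_closure_closed.
  - by exists x, y.
have /(rank_complete_ge d0 gp) : (d <= #|G|).
  exact: ltnW (ltn_trans (d_le_k d0 hk) hG.1).
move/(_ C' (@card_rigidity_closure _ _ _ _)) => h'.
have : (d * #|G| <= rigidity_rank p C' + 'C(d.+1, 2)).
  apply: h' => x y xy; apply/negPn/negP=> xyC; case/negP: h.
  by apply/existsP; exists x; apply/existsP; exists y; rewrite xy.
by clear; lia.
Qed.

(** * Highly connected orientations *)

(** The packed sets are independent, hence sparse by the rank bound for complete graphs. Together
    they have twice the size that sparsity allows on the whole vertex set, so each attains it. *)
Lemma two_sparse_spanning_subgraphs (G : sgraph) d k : 0 < d -> 4 * 'C(d.+1, 2) <= k ->
  k_connected k G ->
  exists H1 H2 : {set {set G}}, [/\ H1 :|: H2 \subset edges G, [disjoint H1 & H2] &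
    forall H, H = H1 \/ H = H2 -> #|H| + 'C(d.+1, 2) = d * #|G| /\
      forall W : {set G}, d <= #|W| -> #|induced H W| + 'C(d.+1, 2) <= d * #|W|].
Proof.
move=> d0 hk hG; have [p gp] := @exists_generic G d.
pose r := rigidity_rank p; pose R := d * #|G| - 'C(d.+1, 2).
have [H1 [H2 [sub dis i1 i2 cR]]] := base_packing (rigidity_rank_submodular p)
  (@rigidity_rank_mono _ _ p) (rigidity_rank_card p)
  (fun C CE => packing_condition d0 gp hk hG CE).
have dG : d <= #|G| by apply: ltnW (ltn_trans (d_le_k d0 hk) hG.1).
have sparse (W : {set G}) (H : {set {set G}}) : H \subset edges G -> #|H| <= r H -> d <= #|W| ->
    #|induced H W| + 'C(d.+1, 2) <= d * #|W|.
  move=> HE iH dW.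
  have iW : induced H W \subset complete W.
    by apply/subsetP=> e; rewrite !in_set => /andP[/(subsetP HE)/card_edge-> ->].
  have iH' : induced H W \subset H by apply/subsetP=> e; rewrite inE => /andP[].
  have h1 := rigidity_rank_complete gp dW; have h2 := rigidity_rank_mono p iW.
  have h3 := rigidity_rank_submodular p (induced H W) (H :\: induced H W).
  have h4 := rigidity_rank_card p (H :\: induced H W).
  have h5 : induced H W :|: H :\: induced H W = H.
    by rewrite -{1}(setIidPr iH') setID.
  have h6 : #|induced H W| + #|H :\: induced H W| = #|H|.
    by rewrite -(cardsID (induced H W) H) (setIidPr iH').
  rewrite h5 in h3; move: h1 h2 h3 h4 h6 iH; rewrite /r; clear; lia.
have ind (H : {set {set G}}) : induced H setT = H by apply/setP=> e; rewrite inE subsetT andbT.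
have H1E : H1 \subset edges G by apply: subset_trans sub; apply: subsetUl.
have H2E : H2 \subset edges G by apply: subset_trans sub; apply: subsetUr.
exists H1, H2; split=> // H hH.
have hH' : H \subset edges G /\ #|H| <= r H by case: hH => ->.
split; last by move=> W; apply: sparse; case: hH'.
have dT : d <= #|[set: G]| by rewrite cardsT.
have := sparse _ _ H1E i1 dT; have := sparse _ _ H2E i2 dT; rewrite !ind cardsT.
by case: hH => ->; move: cR; clear; lia.
Qed.

Lemma degree_sum (G : sgraph) : \sum_(x : G) #|[set y | adj x y]| = 2 * #|edges G|.
Proof.
have deg (x : G) : #|[set y | adj x y]| = \sum_(e in edges G) (x \in e).
  rewrite -(card_in_imset (f := fun y => [set x; y])); last first.
    by move=> y y' _ _ /set2_eq [[]|[-> ->]].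
  rewrite -big_mkcondr sum1_card; apply: eq_card => e.
  rewrite [RHS]inE; apply/imsetP/andP => [[y] | [eE xe]].
    by rewrite inE => a ->; rewrite mem_edges a set21.
  have [a [b [ee ab]]] := edgesP eE; move: xe; rewrite ee !inE => /orP[] /eqP->.
    by exists b; rewrite ?inE.
  by exists a; rewrite ?inE 1?adj_sym // setUC.
rewrite (eq_bigr _ (fun x _ => deg x)) exchange_big /= mulnC -sum_nat_const.
by apply: eq_bigr => e /card_edge <-; rewrite -big_mkcond sum1_card; apply: eq_card.
Qed.

Lemma card_edges_ge (G : sgraph) k : k_connected k G -> k * #|G| <= 2 * #|edges G|.
Proof.
move=> hG; rewrite -degree_sum mulnC -sum_nat_const.
by apply: leq_sum => x _; apply: k_connected_degree.
Qed.

(** [P] is a smallest set carrying enough edges and [H] an exact selection of them; a proper subset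
    with at least [rho] vertices fails the count by minimality. *)
Lemma dense_core (V : finType) (E : {set {set V}}) (kappa beta rho : nat) :
  beta <= kappa -> rho <= #|V| -> kappa * #|V| <= #|E| ->
  exists (P : {set _}) (H : {set {set _}}), [/\ rho <= #|P|, H \subset induced E P,
    #|H| + beta * rho = kappa * #|P| &
    forall W : {set _}, W \subset P -> rho <= #|W| -> #|induced H W| + beta * rho <= kappa * #|W|].
Proof.
move=> bk rV cE.
pose good (P : {set V}) := (rho <= #|P|) && (kappa * #|P| <= #|induced E P| + beta * rho).
have good0 : good setT.
  rewrite /good cardsT rV (_ : induced E setT = E); first by apply: leq_trans cE (leq_addr _ _).
  by apply/setP=> e; rewrite inE subsetT andbT.
have [P /andP[rP gP] minP] := arg_minnP (fun P : {set V} => #|P|) good0.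
have br : beta * rho <= kappa * #|P| by apply: leq_mul.
have [H HE cH] : exists2 H : {set {set V}},
    H \subset induced E P & #|H| = kappa * #|P| - beta * rho.
  by apply: exists_subset_card; rewrite leq_subLR addnC.
have cH' : #|H| + beta * rho = kappa * #|P| by rewrite cH subnK.
exists P, H; split=> // W WP rW.
have [WeqP|WneP] := eqVneq W P.
  by rewrite WeqP -cH' leq_add2r; apply/subset_leq_card/subsetP=> e; rewrite inE => /andP[].
have ltWP : #|W| < #|P| by apply: proper_card; rewrite properEneq WneP.
have : ~~ good W by apply/negP=> /minP; rewrite leqNgt ltWP.
rewrite /good rW -ltnNge => /ltnW; apply: leq_trans; rewrite leq_add2r.
apply/subset_leq_card/subsetP=> e; rewrite !inE => /andP[/(subsetP HE)].
by rewrite inE => /andP[-> _].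
Qed.

Theorem quadratic_connectivity_suffices q : 3 <= q -> connectivity_suffices q (8 * q * q + 8 * q).
Proof.
move=> q3 G hG; set k := 8 * q * q + 8 * q in hG.
(* With this [d] there are ['C(d.+1, 2) = q * d] roots, so fewer than [q] deleted vertices, each
   absorbing [d], leave at least [d] roots. *)
pose d := (2 * q).-1.
have dS : d.+1 = 2 * q by rewrite /d prednK // muln_gt0; lia.
have cd : 'C(d.+1, 2) = q * d.
  by have := double_bin2 d; rewrite [d.+1 * d](_ : _ = 2 * (q * d)) ?dS ?mulnA //; lia.
have d0 : 0 < d by lia.
have hk : 4 * 'C(d.+1, 2) <= k by rewrite cd /k; nia.
have nG := hG.1.
have [H1 [H2 [HE dis sparse]]] := two_sparse_spanning_subgraphs d0 hk hG.
have [cH1 sH1] := sparse H1 (or_introl erefl).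
have [cH2 sH2] := sparse H2 (or_intror erefl).
pose E := edges G :\: (H1 :|: H2).
(* Minimum degree [k] gives [4 * q * q + 4 * q] edges per vertex, of which [H1] and [H2] take fewer
   than [2 * d < 4 * q]. *)
have cE : 4 * q * q * #|G| <= #|E|.
  have := card_edges_ge hG; have : #|edges G| = #|E| + (#|H1| + #|H2|).
    rewrite -(cardsID (H1 :|: H2) (edges G)) (setIidPr HE) addnC.
    by rewrite cardsU disjoint_setI0 // cards0 subn0.
  move=> -> h; have : k * #|G| = 8 * q * q * #|G| + 8 * q * #|G| by rewrite /k mulnDl.
  have : d * #|G| + #|G| = 2 * q * #|G| by rewrite -dS mulSn addnC.
  by move: h cH1 cH2; rewrite -!mulnA; clear; lia.
have [P [HP [rP HPE cHP sHP]]] : exists (P : {set _}) (H : {set {set _}}),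
  [/\ 2 * q * q <= #|P|, H \subset induced E P,
    #|H| + (2 * q * q) * (2 * q * q) = (4 * q * q) * #|P| &
    forall W : {set _}, W \subset P -> 2 * q * q <= #|W| ->
      #|induced H W| + (2 * q * q) * (2 * q * q) <= (4 * q * q) * #|W|].
  apply: dense_core => //; first by lia.
  by apply: leq_trans (ltnW nG); rewrite /k; lia.
have [R RP cR] := exists_subset_card rP.
have [R0 R0R cR0] : exists2 R0 : {set G}, R0 \subset R & #|R0| = 'C(d.+1, 2).
  by apply: exists_subset_card; rewrite cR cd /d; nia.
have /card_gt0P[v0 _] : 0 < #|G| by apply: leq_ltn_trans nG.
have HE1 : H1 \subset edges G by apply: subset_trans HE; apply: subsetUl.
have HE2 : H2 \subset edges G by apply: subset_trans HE; apply: subsetUr.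
have HEP : HP \subset edges G.
  by apply/subsetP=> e /(subsetP HPE); rewrite inE => /andP[/setDP[]].
have card2 (H : {set {set G}}) : H \subset edges G -> {in H, forall e : {set G}, #|e| = 2}.
  by move=> sub e /(subsetP sub)/card_edge.
have root (H : {set {set G}}) : H \subset edges G -> #|H| + 'C(d.+1, 2) = d * #|G| ->
    (forall W : {set G}, d <= #|W| -> #|induced H W| + 'C(d.+1, 2) <= d * #|W|) ->
    exists head : {set G} -> G, {in H, forall e : {set G}, head e \in e} /\
      forall S X : {set G}, X != set0 -> #|S| < q ->
        {in H, forall e : {set G}, head e \in X -> e \subset X :|: S} -> d <= #|R0 :&: X|.
  move=> sub cH sH.
  have [||||||head [h1 h2]] := @rooted_orientation G v0 setT R0 H d 1 d (card2 H sub).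
  - by move=> e _; apply: subsetT.
  - exact: subsetT.
  - by [].
  - by rewrite addn1.
  - by rewrite mul1n cR0 cardsT.
  - by move=> W _; rewrite mul1n cR0; apply: sH.
  exists head; split=> // S X X0 Sq hX.
  have := h2 S X; rewrite setIT !mul1n cR0 cd => /(_ X0 hX) h.
  have : d * #|S| <= d * q.-1 by rewrite leq_mul2l -ltnS (ltn_predK q3) Sq orbT.
  move: h; have : q * d = d * q.-1 + d by rewrite -{1}(ltn_predK q3) mulSn addnC mulnC.
  by clear; lia.
have [h1 [h1e h1X]] := root H1 HE1 cH1 sH1.
have [h2 [h2e h2X]] := root H2 HE2 cH2 sH2.
have [||||||hP [hPe hPX]] :=
  @rooted_orientation G v0 P R HP (4 * q * q) (2 * q * q) (2 * q * q) (card2 HP HEP).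
- by move=> e /(subsetP HPE); rewrite inE => /andP[].
- exact: RP.
- by rewrite !leq_mul.
- by rewrite -!mulnA -mulnDl leqW.
- by rewrite cR.
- by rewrite cR.
(* Edges in none of the three sets get an arbitrary end as head; [v0] only fills in for the empty
   set. *)
pose hd (e : {set G}) := if e \in H1 then h1 e else if e \in HP then hP e
  else odflt v0 [pick z in e].
(* On [H2] the chosen end is the tail, so there the prescribed degrees are out-degrees. *)
pose D : rel G := fun x y => adj x y &&
  (if [set x; y] \in H2 then h2 [set x; y] == x else hd [set x; y] == y).
have hdE (x y : G) : (hd [set x; y] == x) || (hd [set x; y] == y).
  rewrite -in_set2 /hd; case: ifP => [/h1e //|_]; case: ifP => [/hPe //|_].
  by case: pickP => // /(_ x); rewrite set21.
have two (a x y : G) : x != y -> (a == x) || (a == y) -> (a == y) = ~~ (a == x).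
  by move=> /negPf xy /orP[] /eqP ->; rewrite eqxx ?xy // eq_sym xy.
exists D; split.
  split=> [x y /andP[] //|x y a]; have xy := adj_neq a.
  rewrite /D a [adj y x]adj_sym a [[set y; x]]setUC /=; case: ifP => [eH|_]; last exact: two.
  by rewrite (two _ _ _ xy) ?negbK // -in_set2 h2e.
split.
  by apply: leq_trans nG; rewrite ltnS; apply: leq_trans (leq_addl _ _); apply: leq_pmull.
move=> S Sq x y xS yS; apply/negPn/negP=> nxy.
pose Y := [set z | (z \notin S) && connect (delete D S) x z].
pose X := ~: (S :|: Y).
have xY : x \in Y by rewrite inE xS connect0.
have yX : y \in X by rewrite !inE (negPf yS) (negPf nxy).
have noarc (a b : G) : a \in Y -> b \in X -> ~~ D a b.
  rewrite !inE => /andP[aS xa] /norP[bS]; rewrite bS /=; apply: contra => ab.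
  by apply: connect_trans xa (connect1 _); rewrite /delete /= !in_setC aS bS.
have cover (a : G) : [|| a \in X, a \in Y | a \in S].
  by rewrite in_setC in_setU; case: (a \in S); case: (a \in Y).
have X0 : X != set0 by apply/set0Pn; exists y.
have Y0 : Y != set0 by apply/set0Pn; exists x.
have closed_hd (e : {set G}) : e \in edges G -> e \notin H2 -> hd e \in X -> e \subset X :|: S.
  move=> eE eH2 hX; have [a [b [ee ab]]] := edgesP eE.
  have key (a' b' : G) : adj a' b' -> e = [set a'; b'] -> hd e == b' -> e \subset X :|: S.
    move=> ab' ee' /eqP hb; have b'X : b' \in X by rewrite -hb.
    have a'Y : a' \notin Y.
      apply/negP=> a'Y; have /negP := noarc _ _ a'Y b'X; apply.
      by rewrite /D ab' -ee' (negPf eH2) hb eqxx.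
    rewrite ee' subUset !sub1set !in_setU b'X andbT.
    by have := cover a'; rewrite (negPf a'Y).
  have := hdE a b; rewrite -ee => /orP[]; last exact: (key a b ab ee).
  by apply: (key b a); rewrite 1?adj_sym // setUC.
have c1 : d <= #|R0 :&: X|.
  apply: (h1X S X) => // e eH hX; apply: closed_hd; first exact: (subsetP HE1).
    by rewrite (disjointFr dis eH).
  by rewrite /hd eH.
have c2 : d <= #|R0 :&: Y|.
  apply: (h2X S Y) => // e eH hY.
  have [a [b [ee ab]]] := edgesP (subsetP HE2 e eH).
  have key (a' b' : G) : adj a' b' -> e = [set a'; b'] -> h2 e == a' -> e \subset Y :|: S.
    move=> ab' ee' /eqP ha; have a'Y : a' \in Y by rewrite -ha.
    have b'X : b' \notin X.
      apply/negP=> b'X; have /negP := noarc _ _ a'Y b'X; apply.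
      by rewrite /D ab' -ee' eH ha eqxx.
    rewrite ee' subUset !sub1set !in_setU a'Y /=.
    by have := cover b'; rewrite (negPf b'X).
  have := h2e e eH; rewrite {2}ee in_set2 => /orP[]; first exact: (key a b ab ee).
  by apply: (key b a); rewrite 1?adj_sym // setUC.
have XP : X :&: P != set0.
  have /card_gt0P[z /setIP[zR zX]] : 0 < #|R0 :&: X| by apply: leq_trans c1.
  by apply/set0Pn; exists z; rewrite in_setI zX (subsetP RP) // (subsetP R0R).
have c3 := hPX S X XP; rewrite cR in c3.
(* Division by [beta = 2 * q * q], where [kappa = 2 * beta]. *)
have {}c3 : 2 * q * q <= 2 * #|S| + #|R :&: X|.
  have q0 : 0 < 2 * q * q by rewrite !muln_gt0 (ltn_trans _ q3).
  rewrite -(leq_pmul2l q0) mulnDr; apply: leq_trans (c3 _) _.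
    move=> e eH hX; have eE := subsetP HEP e eH.
    have := subsetP HPE e eH; rewrite inE => /andP[/setDP[_]]; rewrite in_setU => /norP[e1 e2] _.
    by apply: closed_hd => //; rewrite /hd (negPf e1) eH.
  by rewrite leq_add2r mulnA [_ * 2]mulnC !mulnA.
have c4 : #|R :&: X| + #|R :&: Y| <= #|R|.
  have e0 : (R :&: X) :&: (R :&: Y) = set0.
    by apply/setP=> z; rewrite !inE; case: (z \in R); case: (z \in S); case: (connect _ _ _).
  by rewrite -cardsUI e0 cards0 addn0 -setIUr subset_leq_card // subsetIl.
have c5 : #|R0 :&: Y| <= #|R :&: Y| by apply/subset_leq_card/setSI.
(* Hence [#|R :&: Y| <= 2 * #|S| <= 2 * (q - 1) < d], against [c2] and [c5]. *)
move: c2 c3 c4 c5 Sq dS; rewrite cR; clear.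
move: #|S| #|R :&: X| #|R :&: Y| #|R0 :&: Y| (2 * q * q); lia.
Qed.

(** * The least sufficient connectivity and its numerical bound *)

Lemma exists_least (P : nat -> Prop) n : P n ->
  exists m, [/\ P m, m <= n & forall k, P k -> m <= k].
Proof.
elim/ltn_ind: n => n IHn Pn.
have [[k [Pk lt]]|h] := classic (exists k, P k /\ k < n).
  have [m [Pm mk hm]] := IHn k lt Pk; exists m; split=> //.
  exact: leq_trans mk (ltnW lt).
exists n; split=> // k Pk; rewrite leqNgt; apply/negP=> lt.
by apply: h; exists k.
Qed.

Local Open Scope ring_scope.

Theorem theorem1p8 (q : nat) (hq : (3 <= q)%N) :
  exists m : nat, is_f q m /\
    m%:R <= (25%:R * q%:R ^+ 2 + 41%:R * q%:R - 16%:R) / 2%:R :> rat.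
Proof.
have [|m [[m0 hm] mk least]] :=
  @exists_least (fun k => (0 < k)%N /\ connectivity_suffices q k) (8 * q * q + 8 * q).
  by split; [move: hq; clear; lia|exact: quadratic_connectivity_suffices].
exists m; split; first by split=> // k k0 hk; apply: least.
have q3 : 3%:R <= q%:R :> rat by rewrite ler_nat.
have hm8 : m%:R <= 8%:R * q%:R * q%:R + 8%:R * q%:R :> rat by rewrite -!natrM -natrD ler_nat.
have sq : 0 <= q%:R * q%:R :> rat by rewrite mulr_ge0 ?ler0n.
(* The claimed bound exceeds [8 * q^2 + 8 * q] by [(9 * q^2 + 25 * q - 16) / 2], which is positive
   for [q >= 3]. *)
by rewrite expr2; move: q3 hm8 sq; clear; move: q%:R m%:R => x y; lra.
Qed.
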